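(* Consider the flow-matching reverse-time SDE $$\mathrm{d}\mathbf{z}_t=\left(\frac{\mathbf{z}_t-\hat{\mathbf{z}}_0(t)}{t}+\frac{\varepsilon_t^2}{2t^2}\bigl(\mathbf{z}_t-(1-t)\hat{\mathbf{z}}_0(t)\bigr)\right)\mathrm{d}t+\varepsilon_t\,\mathrm{d}\mathbf{w}_t ,$$ where $\hat{\mathbf{z}}_0(t)=\mathbb{E}[\mathbf{z}_0\mid\mathbf{z}_t]$ is the clean-latent posterior mean, and consider a reverse step from $t$ to $t'<t$. Assume the frozen posterior mean assumption on this step: the clean-latent posterior mean along the step is treated as approximately constant, i.e., $\hat{\mathbf{z}}_0(s)\approx\hat{\mathbf{z}}_0(t)$ for all $s\in[t',t]$. Then the exact transition from $\mathbf{z}_t$ to $\mathbf{z}_{t'}$ is $$\mathbf{z}_{t'}=(1-t')\hat{\mathbf{z}}_0(t)+\frac{t'}{t}e^{-A(t',t)/2}\bigl(\mathbf{z}_t-(1-t)\hat{\mathbf{z}}_0(t)\bigr)+t'\sqrt{1-e^{-A(t',t)}}\,\mathbf{w},$$ where $A(t',t)=\int_{t'}^{t}\varepsilon_s^2/s^2\,\mathrm{d}s$ and $\mathbf{w}\sim\mathcal{N}(\mathbf{0},\mathbf{I})$ is independent of $\mathbf{z}_t$.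
   Context: Flow-matching path: $\mathbf{z}_t=(1-t)\mathbf{z}_0+t\boldsymbol{\epsilon}$, where $\mathbf{z}_0$ is a clean data latent, $\boldsymbol{\epsilon}\sim\mathcal{N}(\mathbf{0},\mathbf{I})$ is independent of $\mathbf{z}_0$, and $t\in[0,1]$ indexes the noise level (larger $t$ is noisier). Sampling runs backward in time, from larger $t$ to smaller $t$. Let $p_t$ be the density of $\mathbf{z}_t$ and $\mathbf{u}_t$ the flow-matching velocity (the target is $\boldsymbol{\epsilon}-\mathbf{z}_0$). The SDE in the claim is the reverse-time SDE $\mathrm{d}\mathbf{z}_t=(\mathbf{u}_t-\tfrac12\varepsilon_t^2\nabla_{\mathbf{z}}\log p_t(\mathbf{z}_t))\,\mathrm{d}t+\varepsilon_t\,\mathrm{d}\mathbf{w}_t$ rewritten in terms of $\hat{\mathbf{z}}_0(t)$, using the score identity $\nabla_{\mathbf{z}}\log p_t(\mathbf{z}_t)=((1-t)\hat{\mathbf{z}}_0(t)-\mathbf{z}_t)/t^2$. Here $\varepsilon_t\ge 0$ controls the amount of exploration noise and $\mathbf{w}_t$ (with a time subscript) is Brownian motion. The frozen posterior mean assumption is a local approximation over one step (exact when the data distribution is a point mass); under it the SDE becomes linear, and ''exact transition'' refers to the closed-form transition of the SDE under this assumption. *)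

(* Defs.v *)
From mathcomp Require Export all_boot all_order all_algebra.
From mathcomp Require Export all_classical all_reals all_analysis.
Export Order.TTheory GRing.Theory Num.Theory.
Export numFieldNormedType.Exports.

Set Implicit Arguments.
Unset Strict Implicit.
Unset Printing Implicit Defensive.

Local Open Scope classical_set_scope.
Local Open Scope ring_scope.

Section Probability.
Context {dO : measure_display} {Omega : measurableType dO} {R : realType}.
Variable P : probability Omega R.

Definition sigma_of {d : nat} (X : Omega -> 'rV[R]_d) : set_system Omega :=
  g_sigma_preimage (fun i w => X w ord0 i).

Definition random_vector {d : nat} (X : Omega -> 'rV[R]_d) : Prop :=
  sigma_of X `<=` measurable.

Definition indep_sigma (F G : set_system Omega) : Prop :=
  forall A B, F A -> G B -> P (A `&` B) = (P A * P B)%E.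

(** [X ~ N(0, sigma^2 I)]: the law of [X] on boxes, hence on all Borel sets,
    is a product of one-dimensional normal laws with standard deviation
    [sigma]. *)
Definition isotropic_gaussian {d : nat} (sigma : R)
    (X : Omega -> 'rV[R]_d) : Prop :=
  random_vector X /\
  forall B : 'I_d -> set R, (forall i, measurable (B i)) ->
    P [set w | forall i, B i (X w ord0 i)] =
    (\prod_(i < d) normal_prob 0 sigma (B i))%E.

Definition integrable_vector {d : nat} (X : Omega -> 'rV[R]_d) : Prop :=
  forall i, P.-integrable setT (fun w => (X w ord0 i)%:E).

(** [M] is a version of the conditional expectation [E[X | Y]]. *)
Definition is_cond_mean {d k : nat} (X : Omega -> 'rV[R]_d)
    (Y : Omega -> 'rV[R]_k) (M : Omega -> 'rV[R]_d) : Prop :=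
  [/\ sigma_of M `<=` sigma_of Y,
      integrable_vector M &
      forall A, sigma_of Y A -> forall i,
        (\int[P]_(w in A) (M w ord0 i)%:E)%E =
        (\int[P]_(w in A) (X w ord0 i)%:E)%E].

(** Filtrations are indexed by time run backwards: going from [r] down to
    [s <= r] adds information. *)
Definition reverse_filtration (a b : R) (F : R -> set_system Omega) : Prop :=
  (forall s, a <= s <= b -> sigma_algebra setT (F s) /\ F s `<=` measurable) /\
  (forall s r, a <= s -> s <= r -> r <= b -> F r `<=` F s).

Definition adapted {d : nat} (a b : R) (F : R -> set_system Omega)
    (X : R -> Omega -> 'rV[R]_d) : Prop :=
  forall s, a <= s <= b -> sigma_of (X s) `<=` F s.

Definition continuous_paths {d : nat} (a b : R)
    (X : R -> Omega -> 'rV[R]_d) : Prop :=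
  {ae P, forall w, forall i : 'I_d,
    {within `[a, b], continuous (fun s => X s w ord0 i)}}.

(** Brownian motion run from time [b] down to time [a].  Only its increments
    matter, so the value at [b] is not normalized to [0]. *)
Definition reverse_brownian {d : nat} (a b : R) (F : R -> set_system Omega)
    (W : R -> Omega -> 'rV[R]_d) : Prop :=
  [/\ adapted a b F W,
      continuous_paths a b W &
      forall s r, a <= s -> s < r -> r <= b ->
        isotropic_gaussian (Num.sqrt (r - s)) (fun w => W s w - W r w) /\
        indep_sigma (sigma_of (fun w => W s w - W r w)) (F r)].

(** An entry [(c, (l, r))] stands for the step [c 1_[l, r[]. *)
Definition step_fun (st : seq (R * (R * R))) (x : R) : R :=
  \sum_(p <- st) p.1 * \1_(`[p.2.1, p.2.2[%classic : set R) x.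

(** Time runs backwards, so the increment over [l, r[ is [W_l - W_r]. *)
Definition step_int {d : nat} (W : R -> Omega -> 'rV[R]_d)
    (st : seq (R * (R * R))) (w : Omega) : 'rV[R]_d :=
  \sum_(p <- st) p.1 *: (W p.2.1 w - W p.2.2 w).

(** [J] is the Ito integral of the deterministic integrand [f] against [dW]
    from time [b] down to time [a]: the mean-square limit of the integrals of
    step functions converging to [f] in [L^2([a, b])].  By the Ito isometry the
    limit does not depend on the approximating sequence. *)
Definition is_reverse_ito_integral {d : nat} (W : R -> Omega -> 'rV[R]_d)
    (f : R -> R) (a b : R) (J : Omega -> 'rV[R]_d) : Prop :=
  random_vector J /\
  exists st : nat -> seq (R * (R * R)),
    [/\ forall n p, p \in st n -> a <= p.2.1 /\ p.2.1 <= p.2.2 /\ p.2.2 <= b,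
        (\int[lebesgue_measure]_(x in `[a, b])
           ((f x - step_fun (st n) x) ^+ 2)%:E)%E @[n --> \oo] --> 0%E &
        forall i,
          ('E_P[fun w => ((J w ord0 i - step_int W (st n) w ord0 i) ^+ 2)%R])%E
            @[n --> \oo] --> 0%E].

(** [Z] solves [dZ_r = drift_r dr + f_r dW_r] with [r] running from [b] down to
    [a], i.e. [Z_s = Z_b + int_b^s drift_r dr + int_b^s f_r dW_r]; the Lebesgue
    integral changes sign when written over [[s, b]]. *)
Definition reverse_sde_solution {d : nat} (a b : R) (F : R -> set_system Omega)
    (W : R -> Omega -> 'rV[R]_d) (drift : R -> Omega -> 'rV[R]_d) (f : R -> R)
    (Z : R -> Omega -> 'rV[R]_d) : Prop :=
  [/\ adapted a b F Z,
      continuous_paths a b Z,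
      {ae P, forall w, forall i : 'I_d, lebesgue_measure.-integrable `[a, b]
        (fun r => (drift r w ord0 i)%:E)} &
      forall s, a <= s <= b ->
        exists2 J : Omega -> 'rV[R]_d, is_reverse_ito_integral W f s b J &
          {ae P, forall w, Z s w = Z b w
            - \row_i (\int[lebesgue_measure]_(r in `[s, b]) drift r w ord0 i)
            + J w}].

End Probability.

Definition fm_path {R : realType} {d : nat} (t : R) (z0 e : 'rV[R]_d) :
  'rV[R]_d := (1 - t) *: z0 + t *: e.

Definition fm_drift {R : realType} {d : nat} (eps : R -> R) (s : R)
    (zhat z : 'rV[R]_d) : 'rV[R]_d :=
  s^-1 *: (z - zhat) + (eps s ^+ 2 / (2 * s ^+ 2)) *: (z - (1 - s) *: zhat).

Definition noise_exponent {R : realType} (eps : R -> R) (t' t : R) : R :=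
  \int[lebesgue_measure]_(s in `[t', t]) (eps s ^+ 2 / s ^+ 2).

(* Main.v *)
(** Freezing the posterior mean [zhat] turns the SDE for the deviation
    [Y_s = Z_s - (1 - s) zhat] into the linear equation
    [dY = g Y ds + eps dW] with [g = 1/s + eps^2 / (2 s^2)]. With the
    integrating factor [Phi(s) = exp (int_s^t g) = (t/s) exp (A(s, t) / 2)] one
    has, for [t' > 0], [Phi(t') Y_t' = Y_t + int Phi eps dW], and the Wiener
    integral is independent of the information at time [t] and normal with
    variance [int Phi^2 eps^2 = t^2 (exp A - 1)]. No stochastic calculus is
    needed: along a path, [Phi(t') Y_t' - Y_t] is the limit of
    Riemann-Stieltjes sums of [Phi] against the Ito integrals of [eps], and such
    a sum is an L2-limit of sums of Brownian increments, hence normal. At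
    [t' = 0], integrability of the drift forces [Y_0 = 0] because [1/s] is not
    integrable. *)
From HB Require Import structures.
Require Import Defs.
From mathcomp Require Import all_boot all_order all_algebra.
From mathcomp Require Import all_classical all_reals all_analysis.
From mathcomp Require Import measurable_realfun normal_distribution ring lra.
Import Order.TTheory GRing.Theory Num.Theory numFieldNormedType.Exports.

Set Implicit Arguments.
Unset Strict Implicit.
Unset Printing Implicit Defensive.

Local Open Scope classical_set_scope.
Local Open Scope ring_scope.

(** * Centered normal laws on the line *)

Section affine.
Context {R : realType}.
Local Notation mu := (@lebesgue_measure R).
Implicit Types c m : R.

(** The solution concept supplies one Ito integral per time, each with its own approximating steps
    and null set, so no relation between them is known at all times at once. Hence only grid points
    of uniform partitions are used, countably many in all, and integrals from different lower bounds
    are combined after being rewritten over the whole of [[a, b]]. As [eps] is merely measurable,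
    the integrating factor is not differentiated: the error on a cell is compared with the increment
    of its logarithm, and these increments telescope. Normality and independence of the information
    at the starting time travel together in [gauss_indep]. An L2 limit (Ito integrals) and an almost
    sure limit (Riemann-Stieltjes sums) must preserve it; convergence in probability covers both. A
    limit variance 0 gives a Dirac mass, whose distribution function jumps, so it is treated apart.
    Where the noise coefficient vanishes ([t' = 0] or [A = 0]) the formula does not determine [w],
    yet a standard normal vector independent of [Z t] must exist on [Omega]: a rescaled Brownian
    increment over the step serves. *)

Lemma measurable_affine c m : measurable_fun setT (fun x : R => c * x + m).
Proof. by apply: measurable_funD => //; exact: measurable_funM. Qed.

Lemma preimage_affine_itv c m a b : c != 0 ->
  (mu ((fun x => (c * x + m)%R) @^-1` `]a, b]%classic) * `|c|%:E =
   mu `]a, b]%classic)%E.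
Proof.
move=> c0; have [c_gt0|c_le0] := ltP 0 c.
  rewrite (_ : _ @^-1` _ = `](a - m) / c, (b - m) / c]%classic); last first.
    apply/seteqP; split => x /=; rewrite !in_itv/= ltr_pdivrMr// ler_pdivlMr//;
    by rewrite (mulrC x) ltrBlDr lerBrDr.
  rewrite !lebesgue_measure_itv/= !lte_fin ltr_pM2r ?invr_gt0// ltrBDr subrK.
  case: ifPn => _; last by rewrite mul0e.
  by rewrite -!EFinB -EFinM gtr0_norm//; congr EFin; field.
have c_lt0 : c < 0 by rewrite lt_neqAle c0.
(* For [c < 0] the map reverses the order, so the closed end moves to the left. *)
rewrite (_ : _ @^-1` _ = `[(b - m) / c, (a - m) / c[%classic); last first.
  apply/seteqP; split => x /=; rewrite !in_itv/= ltr_ndivlMr// ler_ndivrMr//;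
  by rewrite (mulrC x) ltrBlDr lerBrDr andbC.
rewrite !lebesgue_measure_itv/= !lte_fin ltr_nM2r ?invr_lt0// ltrBDr subrK.
case: ifPn => _; last by rewrite mul0e.
by rewrite -!EFinB -EFinM ltr0_norm//; congr EFin; field.
Qed.

(** The pushforward of Lebesgue measure, multiplied by [|c|], agrees with Lebesgue measure on
    half-open intervals, hence everywhere by uniqueness. *)
Lemma ge0_integral_affine c m (f : R -> \bar R) : c != 0 ->
  measurable_fun setT f -> (forall x, 0 <= f x)%E ->
  (\int[mu]_x f x = `|c|%:E * \int[mu]_x f (c * x + m)%R)%E.
Proof.
move=> c0 mf f0.
have k0 : 0 <= `|c| by [].
pose g := (fun x => c * x + m) : measurableTypeR R -> measurableTypeR R.
have mg : measurable_fun setT g by exact: measurable_affine.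
rewrite -[fun x => f (c * x + m)]/(f \o g) -[in RHS](preimage_setT g).
rewrite -(ge0_integral_pushforward mg mu measurableT mf); last by move=> x _.
rewrite -[`|c|]/((NngNum k0)%:num) -ge0_integral_mscale//.
apply: eq_measure_integral => A mA _.
apply: lebesgue_measure_unique => // _ [[a b]] _ <-.
by rewrite -(preimage_affine_itv m a b c0) muleC.
Qed.
End affine.

Section centered_normal.
Context {R : realType}.
Local Notation mu := (@lebesgue_measure R).
Implicit Types (k u v x : R) (B : set R).

Lemma normal_probE (m s : R) B : measurable B ->
  normal_prob m s B = (\int[mu]_x (normal_pdf m s x * \1_B x)%:E)%E.
Proof.
move=> mB; rewrite /normal_prob [LHS]integral_mkcond.
by apply: eq_integral => x _; rewrite restrict_EFin patch_indic.
Qed.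

Lemma normal_pdf_scale k x : k != 0 ->
  `|k| * normal_pdf 0 `|k| (k * x) = normal_pdf 0 1 x.
Proof.
move=> k0; rewrite !normal_pdfE ?normr_eq0 ?oner_neq0//.
have kn0 : `|k| != 0 by rewrite normr_eq0.
rewrite mulrA; congr (_ * _); last first.
  rewrite /normal_fun !subr0 real_normK ?num_real//; congr expR.
  by rewrite exprMn; field.
rewrite /normal_peak expr1n mul1r -mulrnAr sqrtrM ?sqr_ge0// sqrtr_sqr normr_id.
by rewrite invfM mulrA divff// mul1r.
Qed.

Lemma normal_prob_scale k B : k != 0 -> measurable B ->
  normal_prob 0 1 ((fun x => k * x) @^-1` B) = normal_prob 0 `|k| B.
Proof.
move=> k0 mB; have mk : measurable_fun setT (fun x : R => k * x).
  exact: measurable_funM.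
have mpdf : measurable_fun setT (fun y : R => normal_pdf 0 `|k| y * \1_B y).
  apply: measurable_funM; first exact: measurable_normal_pdf.
  exact: measurable_indic.
have mkB : measurable ((fun x : R => k * x) @^-1` B).
  by rewrite -[X in measurable X]setTI; exact: mk.
rewrite !normal_probE// [RHS](ge0_integral_affine 0 k0); first last.
- by move=> x; rewrite lee_fin mulr_ge0 ?normal_pdf_ge0.
- by apply/measurable_EFinP; exact: mpdf.
rewrite -ge0_integralZl//; first last.
- by move=> x _; rewrite lee_fin mulr_ge0 ?normal_pdf_ge0.
- apply/measurable_EFinP; under eq_fun do rewrite addr0.
  exact: (measurableT_comp mpdf mk).
apply: eq_integral => x _; rewrite -EFinM addr0 mulrA normal_pdf_scale//.
Qed.

(** By symmetry of the normal law only the square of a scale factor matters. This identifies the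
    factors [k * sqrt v] and [sqrt (k ^+ 2 * v)] for any sign of [k], zero included. *)
Lemma normal_prob_sqr_eq (k l : R) B : measurable B -> k ^+ 2 = l ^+ 2 ->
  normal_prob 0 1 ((fun x => k * x) @^-1` B) =
  normal_prob 0 1 ((fun x => l * x) @^-1` B).
Proof.
move=> mB kl; have kl' : `|k| = `|l| by apply/eqP;
  rewrite -(eqrXn2 (n := 2))// !real_normK ?num_real// kl.
have [k0|k0] := eqVneq k 0.
  have -> : l = 0 by apply/eqP; rewrite -normr_eq0 -kl' k0 normr0.
  by rewrite k0.
have l0 : l != 0 by rewrite -normr_eq0 -kl' normr_eq0.
by rewrite (normal_prob_scale k0 mB) (normal_prob_scale l0 mB) kl'.
Qed.

(** Unlike [normal_prob 0 0], this is the Dirac mass at [0] when [v = 0]. *)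
Definition centered_normal v : set (measurableTypeR R) -> \bar R :=
  pushforward (normal_prob 0 1)
    (fun x => Num.sqrt v * x : measurableTypeR R).

Let m_scale v : measurable_fun setT (fun x : R => Num.sqrt v * x).
Proof. exact: measurable_funM. Qed.

Let cn0 v : centered_normal v set0 = 0%E. Proof. by rewrite /centered_normal
  /pushforward preimage_set0 measure0. Qed.
Let cn_ge0 v B : (0 <= centered_normal v B)%E.
Proof. by rewrite /centered_normal /pushforward measure_ge0. Qed.
Let cn_sigma v : semi_sigma_additive (centered_normal v).
Proof.
apply: (@measure_semi_sigma_additive _ _ _
  (pushforward (normal_prob 0 1) (fun x => Num.sqrt v * x : measurableTypeR R))).
exact: m_scale.
Qed.
HB.instance Definition _ v := isMeasure.Build _ _ _ (centered_normal v)
  (cn0 v) (cn_ge0 v) (@cn_sigma v).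
Let cn_setT v : centered_normal v setT = 1%E.
Proof. by rewrite /centered_normal /pushforward preimage_setT probability_setT. Qed.
HB.instance Definition _ v := @Measure_isProbability.Build _ _ _
  (centered_normal v) (cn_setT v).

Lemma centered_normalE v B : 0 < v -> measurable B ->
  centered_normal v B = normal_prob 0 (Num.sqrt v) B.
Proof.
move=> v0 mB; have sv0 : Num.sqrt v != 0 by rewrite gt_eqF ?sqrtr_gt0.
rewrite /centered_normal /pushforward (normal_prob_scale sv0 mB).
rewrite (ger0_norm (sqrtr_ge0 v)); reflexivity.
Qed.

Lemma centered_normal1 B : measurable B -> centered_normal 1 B = normal_prob 0 1 B.
Proof. by move=> mB; rewrite (centered_normalE ltr01 mB) sqrtr1; reflexivity. Qed.

Lemma centered_normal_scale k v B : 0 <= v -> measurable B ->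
  centered_normal v ((fun x => k * x) @^-1` B) = centered_normal (k ^+ 2 * v) B.
Proof.
move=> v0 mB; rewrite /centered_normal /pushforward -comp_preimage.
rewrite [LHS](_ : _ = normal_prob 0 1 ((fun x => (k * Num.sqrt v) * x) @^-1` B)).
  apply: normal_prob_sqr_eq => //.
  by rewrite exprMn !sqr_sqrtr// mulr_ge0 ?sqr_ge0.
by congr normal_prob; apply/seteqP; split => x /=; rewrite mulrA.
Qed.

Lemma centered_normal0 B : centered_normal 0 B = \d_(0 : R) B.
Proof.
rewrite /centered_normal /pushforward sqrtr0 diracE.
have [/set_mem B0|/negP B0] := boolP (0 \in B).
  rewrite (_ : _ @^-1` _ = setT) ?probability_setT//.
  by apply/seteqP; split => x //= _; rewrite mul0r.
rewrite (_ : _ @^-1` _ = set0) ?measure0//.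
by apply/seteqP; split => x //=; rewrite mul0r => /mem_set.
Qed.
End centered_normal.

(** * Convolution of nondegenerate normal laws *)

Section normal_convolution.
Context {R : realType}.
Local Notation mu := (@lebesgue_measure R).
Implicit Types (a b u v x z : R) (B : set R).

Lemma integral_normal_prob (m s : R) (f : R -> \bar R) : measurable_fun setT f ->
  (\int[normal_prob m s]_x `|f x| < +oo)%E ->
  (\int[normal_prob m s]_x f x = \int[mu]_x (f x * (normal_pdf m s x)%:E))%E.
Proof.
move=> mf finf.
have dom := normal_prob_dominates m s.
have mpdf : measurable_fun setT (fun x : R => (normal_pdf m s x)%:E).
  by apply/measurable_EFinP; exact: measurable_normal_pdf.
rewrite -(Radon_Nikodym_change_of_variables dom)//=; last exact/integrableP.
apply: ae_eq_integral => //.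
- by apply: emeasurable_funM => //; apply: (measurable_int mu);
  exact: Radon_Nikodym_integrable.
- by apply: emeasurable_funM.
(* The Radon-Nikodym derivative and the density have the same integral over every measurable set,
   hence agree almost everywhere. *)
- apply: ae_eqe_mul2l => /=.
  rewrite Radon_NikodymE//=; case: cid => /= h [h1 h2 h3].
  by apply: integral_ae_eq => //= E _ mE; rewrite -h3.
Qed.

(** Completing the square in [x]: the joint density of [(X, X + Y)] is written as the density of the
    sum times the conditional density of [X] given that the sum is [z]. *)
Lemma normal_pdf_convolution a b x z : a != 0 -> b != 0 ->
  normal_pdf 0 a x * normal_pdf x b z =
  normal_pdf 0 (Num.sqrt (a ^+ 2 + b ^+ 2)) z *
  normal_pdf (z * a ^+ 2 / (a ^+ 2 + b ^+ 2))
    (a * b / Num.sqrt (a ^+ 2 + b ^+ 2)) x.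
Proof.
move=> a0 b0.
have a2 : 0 < a ^+ 2 by rewrite exprn_even_gt0.
have b2 : 0 < b ^+ 2 by rewrite exprn_even_gt0.
have c2 : 0 < a ^+ 2 + b ^+ 2 by exact: addr_gt0.
have c0 : Num.sqrt (a ^+ 2 + b ^+ 2) != 0 by rewrite gt_eqF ?sqrtr_gt0.
have pi0 := pi_gt0 R.
rewrite !normal_pdfE//; last first.
  by rewrite !mulf_neq0 ?invr_neq0.
rewrite mulrACA [in RHS]mulrACA; congr (_ * _).
  have ge0 s : 0 <= s ^+ 2 * pi *+ 2 :> R.
    by rewrite mulrn_wge0// mulr_ge0 ?sqr_ge0 ?(ltW pi0).
  rewrite /normal_peak -!invfM -!sqrtrM//.
  congr (Num.sqrt _)^-1; rewrite !exprMn exprVn sqr_sqrtr ?(ltW c2)//.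
  by field; rewrite gt_eqF.
rewrite /normal_fun -!expRD; congr expR.
rewrite !exprMn exprVn sqr_sqrtr ?(ltW c2)//.
by field; rewrite a0 b0 gt_eqF.
Qed.

Lemma normal_prob_convolution a b B : a != 0 -> b != 0 -> measurable B ->
  (normal_prob 0 a \x normal_prob 0 b)%E ((fun p => p.1 + p.2) @^-1` B) =
  normal_prob 0 (Num.sqrt (a ^+ 2 + b ^+ 2)) B.
Proof.
move=> a0 b0 mB.
have mS : measurable ((fun p : R * R => p.1 + p.2) @^-1` B).
  by rewrite -[X in measurable X]setTI; apply: measurable_funD => //.
(* The joint density of [(X, X + Y)], restricted to sums in [B]. *)
pose G (p : R * R) : \bar R :=
  (normal_pdf p.1 b p.2 * \1_B p.2 * normal_pdf 0 a p.1)%:E.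
have mnb : measurable_fun setT (fun p : R * R => normal_pdf p.1 b p.2).
  rewrite (_ : (fun p : R * R => _) =
      (normal_pdf 0 b : R -> R) \o (fun p : R * R => p.2 - p.1)); last first.
    apply/funext => p /=; rewrite !normal_pdfE//.
    by rewrite (normal_fun_center p.1)/= /normal_fun/= !subr0.
  apply: measurableT_comp; first exact: measurable_normal_pdf.
  exact: measurable_funB.
have mBs : measurable_fun setT (fun p : R * R => (\1_B p.2 : R)).
  exact: (measurableT_comp (measurable_indic mB) measurable_snd).
have mna : measurable_fun setT (fun p : R * R => normal_pdf 0 a p.1).
  exact: (measurableT_comp (measurable_normal_pdf _ _) measurable_fst).
have mG : measurable_fun setT G.
  apply/measurable_EFinP; apply: measurable_funM => //.
  exact: measurable_funM.
have G0 p : (0 <= G p)%E.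
  by rewrite lee_fin !mulr_ge0 ?normal_pdf_ge0// indicE.
have Hx x : normal_prob 0 b (xsection ((fun p : R * R => p.1 + p.2) @^-1` B) x) =
    (\int[mu]_z (normal_pdf x b z * \1_B z)%:E)%E.
  rewrite normal_probE//; last exact: measurable_xsection.
  rewrite [RHS](@ge0_integral_affine _ 1 x) ?oner_neq0//; first last.
  - by move=> y; rewrite lee_fin mulr_ge0 ?normal_pdf_ge0// indicE.
  - apply/measurable_EFinP; apply: measurable_funM; last exact: measurable_indic.
    exact: measurable_normal_pdf.
  rewrite normr1 mul1e; apply: eq_integral => y _; congr (_%:E).
  rewrite mul1r !normal_pdfE// /normal_fun subr0 addrK; congr (_ * _).
  rewrite !indicE mem_xsection addrC.
  by congr (nat_of_bool _)%:R; apply/idP/idP; rewrite !inE.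
rewrite /product_measure1 /= integral_normal_prob; first last.
- apply: (@le_lt_trans _ _ (\int[normal_prob 0 a]_x (cst 1 x))%E); last first.
    rewrite integral_cst// mul1e.
    exact: (le_lt_trans (probability_le1 _ measurableT) (ltry 1)).
  apply: ge0_le_integral => //=.
  + by apply: measurableT_comp => //; exact: measurable_fun_xsection.
  + by move=> x _; rewrite gee0_abs ?probability_le1//; exact: measurable_xsection.
- exact: measurable_fun_xsection.
transitivity (\int[mu]_x \int[mu]_z G (x, z))%E.
  apply: eq_integral => x _ /=; rewrite Hx -ge0_integralZr//; first last.
  - by rewrite lee_fin normal_pdf_ge0.
  - by move=> y _; rewrite lee_fin mulr_ge0 ?normal_pdf_ge0// indicE.
  - apply/measurable_EFinP; apply: measurable_funM; last exact: measurable_indic.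
    exact: measurable_normal_pdf.
(* With [x] now integrated first, the conditional density integrates to 1 and the density of the sum
   remains. *)
rewrite fubini_tonelli// normal_probE//; apply: eq_integral => z _.
rewrite /G/=.
under eq_integral => x _ do
  rewrite mulrAC [in X in (X * _)%:E]mulrC normal_pdf_convolution// mulrAC EFinM.
rewrite ge0_integralZl//; first last.
- by rewrite lee_fin mulr_ge0 ?normal_pdf_ge0// indicE.
- by move=> x _; rewrite lee_fin normal_pdf_ge0.
- by apply/measurable_EFinP; exact: measurable_normal_pdf.
by rewrite integral_normal_pdf mule1.
Qed.
End normal_convolution.

(** * Sums, distribution function and tails of centered normal laws *)

Section centered_normal_theory.
Context {R : realType}.
Local Notation mu := (@lebesgue_measure R).
Implicit Types (u v x y : R) (B : set R).

(** A zero variance has no density and is handled first: convolution with a Dirac mass at 0 changes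
    nothing. *)
Lemma centered_normalD u v B : 0 <= u -> 0 <= v -> measurable B ->
  (centered_normal u \x centered_normal v)%E ((fun p => p.1 + p.2) @^-1` B) =
  centered_normal (u + v) B.
Proof.
move=> u0 v0 mB.
have mS : measurable ((fun p : R * R => p.1 + p.2) @^-1` B).
  by rewrite -[X in measurable X]setTI; apply: measurable_funD => //.
have S x : xsection ((fun p : R * R => p.1 + p.2) @^-1` B) x =
    (fun y => x + y) @^-1` B.
  by apply/seteqP; split => y; rewrite /xsection/= inE.
have [->|un0] := eqVneq u 0.
  rewrite add0r /product_measure1 (@eq_measure_integral _ _ _ _ (\d_(0 :
    measurableTypeR R))).
    rewrite integral_dirac ?diracT ?mul1e//= ?S; last exact: measurable_fun_xsection.
    by congr centered_normal; apply/seteqP; split => y /=; rewrite add0r.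
  by move=> A _ _; exact: centered_normal0.
have [->|vn0] := eqVneq v 0.
  rewrite addr0 -[RHS]/(centered_normal u B) -[in RHS](setIT B) -integral_indic//.
  apply: eq_integral => x _ /=; rewrite S centered_normal0 diracE indicE.
  by congr (nat_of_bool _)%:R%:E; apply/idP/idP; rewrite !inE/= ?addr0.
have {un0} u_gt0 : 0 < u by rewrite lt_def un0.
have {vn0} v_gt0 : 0 < v by rewrite lt_def vn0.
have su0 : Num.sqrt u != 0 by rewrite gt_eqF ?sqrtr_gt0.
have sv0 : Num.sqrt v != 0 by rewrite gt_eqF ?sqrtr_gt0.
rewrite (centered_normalE (addr_gt0 u_gt0 v_gt0) mB).
have := normal_prob_convolution su0 sv0 mB; rewrite (sqr_sqrtr u0) (sqr_sqrtr v0) => <-.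
rewrite /product_measure1.
transitivity (\int[normal_prob 0 (Num.sqrt u)]_x (centered_normal v \o
    xsection ((fun p : R * R => (p.1 + p.2)%R) @^-1` B)) x)%E.
  apply: eq_measure_integral => A mA _; exact: (centered_normalE u_gt0).
apply: eq_integral => x _; apply: (centered_normalE v_gt0).
exact: measurable_xsection.
Qed.

Lemma normal_prob_fin_num B : measurable B -> normal_prob 0 1 B \is a fin_num.
Proof. by move=> mB; exact: (fin_num_measure (normal_prob 0 1)). Qed.

Local Opaque normal_prob.

Definition normal_cdf x : R := fine (normal_prob 0 1 `]-oo, x]).

Lemma normal_cdfE x : (normal_cdf x)%:E = normal_prob 0 1 `]-oo, x].
Proof. by rewrite /normal_cdf (fineK (normal_prob_fin_num _)). Qed.

(** The density is bounded by its peak. *)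
Lemma normal_cdf_lipschitz x y : x <= y ->
  0 <= normal_cdf y - normal_cdf x <= @normal_peak R 1 * (y - x).
Proof.
move=> xy; have -> : normal_cdf y - normal_cdf x = fine (normal_prob 0 1 `]x, y]).
  apply: EFin_inj; rewrite EFinB (normal_cdfE y) (normal_cdfE x) (fineK
    (normal_prob_fin_num (measurable_itv _))).
  have -> : `]-oo, y]%classic = `]-oo, x] `|` `]x, y] :> set R.
    by rewrite -itv_bndbnd_setU ?bnd_simp.
  rewrite measureU; [|exact: measurable_itv|exact: measurable_itv|];
    first by rewrite addeAC subee ?add0e// normal_prob_fin_num.
  apply/seteqP; split => z //=; rewrite !in_itv/= => -[zx /andP[]].
  by rewrite ltNge zx.
rewrite fine_ge0 ?measure_ge0//= -lee_fin (fineK (normal_prob_fin_num (measurable_itv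
  _))).
apply: (@le_trans _ _ (\int[mu]_(z in `]x, y]) (@normal_peak R 1)%:E)%E).
  apply: ge0_le_integral => //=.
  - by move=> z _; rewrite lee_fin normal_pdf_ge0.
  - by apply/measurable_EFinP/measurable_funTS; exact: measurable_normal_pdf.
  - by move=> z _; rewrite lee_fin normal_pdf_ub ?oner_neq0.
rewrite integral_cst//= EFinM lebesgue_measure_itv/= lte_fin.
case: ifPn => // _; rewrite mule0 mule_ge0// lee_fin ?normal_peak_ge0//.
by rewrite subr_ge0.
Qed.

Lemma continuous_normal_cdf : continuous normal_cdf.
Proof.
move=> x; apply/cvgrPdist_lt => e e0.
have pk0 : 0 < @normal_peak R 1 by rewrite normal_peak_gt0.
near=> y; apply: (@le_lt_trans _ _ (@normal_peak R 1 * `|x - y|)).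
  have [xy|/ltW yx] := leP x y.
    have /andP[h0 h] := normal_cdf_lipschitz xy.
    by rewrite distrC (ger0_norm h0) (distrC x) ger0_norm ?subr_ge0.
  have /andP[h0 h] := normal_cdf_lipschitz yx.
  by rewrite (ger0_norm h0) ger0_norm ?subr_ge0.
rewrite mulrC -ltr_pdivlMr//; near: y.
by apply: cvgr_dist_lt => //; rewrite divr_gt0.
Unshelve. all: by end_near. Qed.

(** One continuous function describes all positive variances, so ray probabilities are continuous in
    [v] as well as in [x]. *)
Lemma centered_normal_ray v x : 0 < v ->
  centered_normal v `]-oo, x] = (normal_cdf (x / Num.sqrt v))%:E.
Proof.
move=> v0; rewrite normal_cdfE /centered_normal /pushforward; congr normal_prob.
apply/seteqP; split => y /=; rewrite !in_itv/= ler_pdivlMr ?sqrtr_gt0//;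
by rewrite mulrC.
Qed.

(** Continuity from above along the sets [n <= |x|], whose intersection is empty. *)
Lemma normal_prob_tail (e : R) : 0 < e ->
  exists2 K : R, 0 < K & (normal_prob 0 1 [set x : R | (K <= `|x|)%R] <= e%:E)%E.
Proof.
move=> e0; pose A n := [set x : R | n%:R <= `|x|].
have mA n : measurable (A n).
  rewrite (_ : A n = Num.norm @^-1` `[n%:R, +oo[); last first.
    by apply/seteqP; split => x; rewrite /A/= in_itv/= andbT.
  by rewrite -[X in measurable X]setTI; exact: normr_measurable.
have AI : \bigcap_n A n = set0.
  apply/seteqP; split => x //= /(_ (Num.truncn `|x|).+1 Logic.I); rewrite /A/=.
  by rewrite leNgt truncnS_gt.
have : normal_prob 0 1 (A n) @[n --> \oo] --> normal_prob 0 1 (\bigcap_n A n).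
  apply: nonincreasing_cvg_mu => //.
  - by rewrite ltey_eq normal_prob_fin_num.
  - by rewrite AI.
  - move=> m n mn; apply/subsetPset => x; rewrite /A/=; apply: le_trans.
    by rewrite ler_nat.
rewrite AI measure0 => /fine_cvgP[_ /cvgrPdist_le/(_ e e0)[n _ /(_ n.+1)]].
rewrite /= => /(_ (leqnSn _)) h; exists n.+1%:R => //.
move: h; rewrite sub0r normrN ger0_norm ?fine_ge0 ?measure_ge0// -lee_fin.
by rewrite (fineK (normal_prob_fin_num _)).
Qed.
End centered_normal_theory.

(** * Gaussian vectors independent of a sigma-algebra *)

Section product_law.
Context {dO : measure_display} {Omega : measurableType dO} {R : realType}.
Variable P : probability Omega R.
Context {dT : measure_display} {T : measurableType dT}.
Variable m : probability T R.
Variables (G : set_system T) (g : (set T)^nat).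
Hypotheses (GE : measurable = <<s G >>) (GI : setI_closed G)
  (Gg : forall n, G (g n)) (g_cover : \bigcup_n g n = setT).

Lemma measurable_box {d : nat} (U : 'I_d -> Omega -> T) (B : 'I_d -> set T) :
  (forall i, measurable_fun setT (U i)) -> (forall i, measurable (B i)) ->
  measurable [set w | forall i, B i (U i w)].
Proof.
move=> mU mB.
rewrite (_ : mkset _ = \bigcap_(i in [set: 'I_d]) (U i @^-1` B i)); last first.
  by apply/seteqP; split => [w h i _|w h i]; exact: h.
apply: fin_bigcap_measurable => // i _; rewrite -[X in measurable X]setTI.
exact: mU.
Qed.

Let G_measurable A : G A -> measurable A.
Proof. by move=> GA; rewrite GE; exact: sub_sigma_algebra. Qed.

(** The coordinates are released one at a time from the generating pi-system. *)
Lemma box_law_ext {d : nat} (C : set Omega) (U : 'I_d -> Omega -> T) :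
  measurable C -> (forall i, measurable_fun setT (U i)) ->
  (forall B, (forall i, G (B i)) ->
    P (C `&` [set w | forall i, B i (U i w)]) = (P C * \prod_i m (B i))%E) ->
  forall B, (forall i, measurable (B i)) ->
    P (C `&` [set w | forall i, B i (U i w)]) = (P C * \prod_i m (B i))%E.
Proof.
move=> mC mU HG.
(* Coordinates below [k] range over all measurable sets, the others still over [G]. *)
suff H k : forall B, (forall i, measurable (B i)) ->
    (forall i : 'I_d, (k <= i)%N -> G (B i)) ->
    P (C `&` [set w | forall i, B i (U i w)]) = (P C * \prod_i m (B i))%E.
  by move=> B mB; apply: (H d) => // i; rewrite leqNgt ltn_ord.
elim: k => [|k IH] B mB BG; first by apply: HG => i; exact: BG.
have [dk|kd] := leqP d k.
  by apply: IH => // i ki; move: (ltn_ord i); rewrite ltnNge (leq_trans dk ki).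
pose k0 := Ordinal kd.
pose upd (A : set T) i := if i == k0 then A else B i.
pose E := C `&` [set w | forall i, upd setT i (U i w)].
have mupd A i : measurable A -> measurable (upd A i) by rewrite /upd; case: ifP.
have mE : measurable E by apply: measurableI => //; apply: measurable_box => // i;
  exact: mupd.
have updE A : E `&` (U k0 @^-1` A) = C `&` [set w | forall i, upd A i (U i w)].
  apply/seteqP; split => w /=.
    move=> [[Cw h] hA]; split => // i; have := h i.
    by rewrite /upd; case: eqVneq => // ->.
  move=> [Cw h]; split; last by have := h k0; rewrite /upd eqxx.
  split => // i; have := h i.
  by rewrite /upd; case: eqVneq.
pose c := (P C * \prod_(i | i != k0) m (B i))%E.
have c_fin : c \is a fin_num.
  rewrite /c fin_numM// ?fin_num_measure//; apply:
    (big_ind (fun x => x \is a fin_num)) => //.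
  - by move=> x y; exact: fin_numM.
  - by move=> i _; exact: fin_num_measure.
have c_ge0 : 0 <= fine c.
  by rewrite fine_ge0// mule_ge0// prode_ge0.
have prodE A : (P C * \prod_i m (upd A i) = c * m A)%E.
  rewrite (bigD1 k0)//= /upd eqxx muleCA muleC; congr (_ * _ * _)%E.
  by apply: eq_bigr => i /negbTE ->.
have BE : B = upd (B k0).
  by apply/funext => i; rewrite /upd; case: eqVneq => [->|].
rewrite BE prodE -updE -[c]fineK//.
rewrite -[X in (X%:E * _)%E]/((NngNum c_ge0)%:num) setIC.
rewrite -[LHS]/(pushforward (mrestr P mE) (U k0) (B k0)).
rewrite -[RHS]/(mscale (NngNum c_ge0) m (B k0)).
apply: (measure_unique G g) => //.
- move=> A GA; rewrite -[RHS]/((fine c)%:E * m A)%E fineK// -prodE.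
  rewrite -[LHS]/(P ((U k0 @^-1` A) `&` E)) setIC updE.
  apply: IH => [i|i ki]; first by apply: mupd; exact: G_measurable.
  rewrite /upd; case: eqVneq => // ik0; apply: BG.
  by rewrite ltn_neqAle ki andbT eq_sym; apply: contra ik0 => /eqP ik;
    apply/eqP/val_inj.
- move=> n; rewrite -[X in (X < _)%E]/(P ((U k0 @^-1` g n) `&` E)).
  apply: (le_lt_trans (probability_le1 _ _)); last exact: ltry.
  apply: measurableI => //; rewrite -[X in measurable X]setTI.
  by apply: mU => //; exact: G_measurable.
Qed.
End product_law.

Section gauss_indep.
Context {dO : measure_display} {Omega : measurableType dO} {R : realType}.
Variable P : probability Omega R.
Implicit Types (F G : set_system Omega) (C : set Omega) (u v : R).

Lemma sigma_of_coord {d : nat} (X : Omega -> 'rV[R]_d) i A : measurable A ->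
  sigma_of X ((fun w => X w ord0 i) @^-1` A).
Proof.
move=> mA; apply: sub_sigma_algebra; rewrite -bigcup_seq/=.
by exists i => /=; [rewrite mem_index_enum|exists A => //; rewrite setTI].
Qed.

Lemma sigma_of_box {d : nat} (X : Omega -> 'rV[R]_d) (B : 'I_d -> set R) :
  (forall i, measurable (B i)) ->
  sigma_of X [set w | forall i, B i (X w ord0 i)].
Proof.
move=> mB; pose S := g_sigma_algebraType (\big[setU/set0]_(i < d)
  preimage_set_system setT (fun w => X w ord0 i) measurable).
apply: (@measurable_box _ S _ _ d (fun i w => X w ord0 i) B) => // i _ A mA.
by rewrite setTI; exact: sigma_of_coord.
Qed.

Lemma sigma_of_sub {d : nat} (X : Omega -> 'rV[R]_d) F : sigma_algebra setT F ->
  (forall i A, measurable A -> F ((fun w => X w ord0 i) @^-1` A)) ->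
  sigma_of X `<=` F.
Proof.
move=> sF XF; apply: smallest_sub => //.
apply: (big_ind (fun S : set_system Omega => S `<=` F)) => //.
  by move=> S1 S2 h1 h2 A [/h1|/h2].
by move=> i _ _ [A mA <-]; rewrite setTI; exact: XF.
Qed.

Lemma random_vectorP {d : nat} (X : Omega -> 'rV[R]_d) :
  random_vector X <-> forall i, measurable_fun setT (fun w => X w ord0 i).
Proof.
split=> [h i _ A mA|h].
  by rewrite setTI; apply: h; exact: sigma_of_coord.
apply: sigma_of_sub; first exact: sigma_algebra_measurable.
by move=> i A mA; rewrite -[X in measurable X]setTI; exact: h.
Qed.

Lemma sigma_algebraI F A B : sigma_algebra setT F -> F A -> F B -> F (A `&` B).
Proof.
move=> sF; rewrite -(sigma_algebra_id sF) => FA FB.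
exact: (@measurableI _ (g_sigma_algebraType F)).
Qed.

Lemma sigma_algebraT F : sigma_algebra setT F -> F setT.
Proof. by case=> F0 FC _; rewrite -(setD0 setT); exact: FC. Qed.

(** Law [N(0, v I)] and independence of [F] in a single condition, which is
    stable under limits in probability; [v = 0] is allowed. *)
Definition gauss_indep {d : nat} F v (X : Omega -> 'rV[R]_d) :=
  random_vector X /\
  forall C, F C -> forall B : 'I_d -> set R, (forall i, measurable (B i)) ->
    P (C `&` [set w | forall i, B i (X w ord0 i)]) =
    (P C * \prod_(i < d) centered_normal v (B i))%E.

Lemma gauss_indep0 {d : nat} F : F `<=` measurable ->
  gauss_indep F 0 (fun _ : Omega => 0 : 'rV[R]_d).
Proof.
move=> Fm; split.
  apply/random_vectorP => i; under eq_fun do rewrite mxE.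
  exact: measurable_cst.
move=> C FC B mB.
have [B0|] := pselect (forall i, B i 0).
  rewrite (_ : [set w | _] = setT); last first.
    by apply/seteqP; split => w //= _ i; rewrite mxE.
  rewrite setIT big1 ?mule1// => i _.
  by rewrite centered_normal0 diracE mem_set.
move=> /existsNP[i B0].
rewrite (_ : [set w | _] = set0); last first.
  by apply/seteqP; split => w //= /(_ i); rewrite mxE.
rewrite setI0 measure0 (bigD1 i)//= centered_normal0 diracE memNset//.
by rewrite mul0e mule0.
Qed.

Lemma gauss_indepZ {d : nat} F v (X : Omega -> 'rV[R]_d) k : 0 <= v ->
  gauss_indep F v X -> gauss_indep F (k ^+ 2 * v) (fun w => k *: X w).
Proof.
move=> v0 [/random_vectorP mX hX]; split.
  apply/random_vectorP => i; under eq_fun do rewrite mxE.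
  exact: measurable_funM.
move=> C FC B mB.
have mk : measurable_fun setT (fun x : R => k * x) by exact: measurable_funM.
have mkB i : measurable ((fun x => k * x) @^-1` B i).
  by rewrite -[X in measurable X]setTI; exact: mk.
have := hX C FC (fun i => (fun x => k * x) @^-1` B i) mkB.
rewrite [X in C `&` X](_ : _ = [set w | forall i, B i ((k *: X w) ord0 i)]).
  move=> ->; congr (_ * _)%E; apply: eq_bigr => i _.
  exact: centered_normal_scale.
by apply/seteqP; split => w /= h i; have := h i; rewrite mxE.
Qed.

Lemma gauss_indep_normalize {d : nat} F v (X : Omega -> 'rV[R]_d) : 0 < v ->
  gauss_indep F v X -> gauss_indep F 1 (fun w => (Num.sqrt v)^-1 *: X w).
Proof.
move=> v0 /(gauss_indepZ (Num.sqrt v)^-1 (ltW v0)).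
have -> : (Num.sqrt v)^-1 ^+ 2 * v = 1 by rewrite exprVn sqr_sqrtr ?ltW// mulVf//
  gt_eqF.
exact.
Qed.

(** The convolution is carried out coordinate by coordinate, on the pairs
    [(X_i, Y_i)]. *)
Lemma gauss_indepD {d : nat} F G u v (X Y : Omega -> 'rV[R]_d) :
  sigma_algebra setT G -> F `<=` G -> G `<=` measurable ->
  0 <= u -> 0 <= v ->
  gauss_indep G u X -> gauss_indep F v Y -> sigma_of Y `<=` G ->
  gauss_indep F (u + v) (fun w => X w + Y w).
Proof.
move=> sG FG Gm u0 v0 [/random_vectorP mX hX] [/random_vectorP mY hY] YG; split.
  apply/random_vectorP => i; under eq_fun do rewrite mxE.
  exact: measurable_funD.
move=> C FC B mB.
pose T := measurableTypeR R.
pose U (i : 'I_d) w : T * T := (X w ord0 i, Y w ord0 i).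
pose m : probability (T * T)%type R := (centered_normal u \x centered_normal v)%E.
pose Rect := [set D : set (T * T) | exists A1 A2,
  [/\ measurable A1, measurable A2 & D = A1 `*` A2]].
pose D i : set (T * T) := (fun p => p.1 + p.2) @^-1` B i.
have mD i : measurable (D i).
  rewrite -[X in measurable X]setTI.
  by apply: (measurable_funD measurable_fst measurable_snd).
have -> : [set w | forall i, B i ((X w + Y w) ord0 i)] =
    [set w | forall i, D i (U i w)].
  by apply/seteqP; split => w /= h i; have := h i; rewrite mxE.
have -> : (\prod_(i < d) centered_normal (u + v) (B i) = \prod_(i < d) m (D i))%E.
  by apply: eq_bigr => i _; rewrite -(centered_normalD u0 v0 (mB i)).
apply: (@box_law_ext _ _ _ P _ _ m Rect (fun=> setT)) => //.
- rewrite measurable_prod_measurableType; congr (<<s _ >>).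
  apply/seteqP; split => [_ [A1 mA1 [A2 mA2 <-]]|_ [A1 [A2 [mA1 mA2 ->]]]].
    by exists A1, A2.
  by exists A1 => //; exists A2.
- move=> _ _ [A1 [A2 [mA1 mA2 ->]]] [A1' [A2' [mA1' mA2' ->]]].
  exists (A1 `&` A1'), (A2 `&` A2'); split; [exact: measurableI..|].
  by rewrite setXI.
- by move=> _; exists setT, setT; split => //; rewrite setXTT.
- by apply/seteqP; split => // x _; exists 0%N.
- exact/Gm/FG.
- by move=> i; apply/measurable_fun_pairP; split; [exact: mX|exact: mY].
move=> B' /choice[A1 /choice[A2 HA]].
have mA1 i : measurable (A1 i) by have [] := HA i.
have mA2 i : measurable (A2 i) by have [] := HA i.
have -> : C `&` [set w | forall i, B' i (U i w)] =
  (C `&` [set w | forall i, A2 i (Y w ord0 i)]) `&`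
  [set w | forall i, A1 i (X w ord0 i)].
  apply/seteqP; split => w /=.
    move=> [Cw h]; split; [split => //|] => i; have := h i;
    by have [_ _ ->] := HA i; case.
  by move=> [[Cw h2] h1]; split => // i; have [_ _ ->] := HA i; split.
(* The event that [C] holds and [Y] lies in its box belongs to [G], of which [X] is independent;
   independence of [Y] from [F] is used only afterwards. *)
rewrite hX//; last first.
  by apply: sigma_algebraI => //; [exact: FG|apply: YG; exact: (@sigma_of_box _ Y)].
rewrite hY// -muleA -big_split/=; congr (_ * _)%E; apply: eq_bigr => i _.
by have [_ _ ->] := HA i; rewrite product_measure1E// muleC.
Qed.

Lemma gauss_indep_marginal {d : nat} F v (X : Omega -> 'rV[R]_d) i A :
  F setT -> gauss_indep F v X -> measurable A ->
  P ((fun w => X w ord0 i) @^-1` A) = centered_normal v A.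
Proof.
move=> FT [_ hX] mA.
have := hX setT FT (fun j => if j == i then A else setT).
rewrite setTI probability_setT mul1e (bigD1 i)//= eqxx big1 ?mule1; last first.
  by move=> j /negbTE ->; rewrite probability_setT.
move=> <-; last by move=> j; case: ifP.
congr (P _); apply/seteqP; split => w /=.
  by move=> h j; case: eqVneq => // ->.
by move=> /(_ i); rewrite eqxx.
Qed.
End gauss_indep.

(** * Stability under limits in probability *)

Section gauss_indep_limit.
Context {dO : measure_display} {Omega : measurableType dO} {R : realType}.
Variable P : probability Omega R.
Implicit Types (F : set_system Omega) (C : set Omega).

Lemma cvg_prod_ord {d : nat} (f : nat -> 'I_d -> R) (l : 'I_d -> R) :
  (forall i, f n i @[n --> \oo] --> l i) ->
  \prod_i f n i @[n --> \oo] --> \prod_i l i.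
Proof.
move=> fl.
suff H (s : seq 'I_d) :
    \prod_(i <- s) f n i @[n --> \oo] --> \prod_(i <- s) l i by exact: H.
elim: s => [|i s IH].
  by rewrite big_nil; under eq_fun do rewrite big_nil; exact: cvg_cst.
by rewrite big_cons; under eq_fun do rewrite big_cons; exact: cvgM.
Qed.

Lemma measurable_rays : @measurable _ (measurableTypeR R) =
  <<s [set A | exists x : R, A = `]-oo, x]%classic] >>.
Proof.
apply/seteqP; split.
  rewrite [X in X `<=` _](RGenOInfty.measurableE R).
  apply: smallest_sub; first exact: smallest_sigma_algebra.
  move=> _ [x ->]; rewrite -setCitvl.
  apply: sigma_algebraC; apply: sub_sigma_algebra.
  by exists x.
apply: smallest_sub; first exact: sigma_algebra_measurable.
by move=> _ [x ->]; exact: (measurable_itv `]-oo, x]).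
Qed.

Lemma le_measure_bigsetU {d : nat} (D : 'I_d -> set Omega) :
  (forall i, measurable (D i)) ->
  (P (\big[setU/set0]_i D i) <= \sum_i P (D i))%E.
Proof.
move=> mD.
suff [] : measurable (\big[setU/set0]_i D i) /\
    (P (\big[setU/set0]_i D i) <= \sum_i P (D i))%E by [].
apply: (big_ind2 (fun (A : set Omega) (x : \bar R) => measurable A /\ (P A <= x)%E)).
- by split; rewrite ?measure0.
- move=> A x B y [mA Ax] [mB By]; split; first exact: measurableU.
  by rewrite (le_trans (measureU2 _ mA mB))// leeD.
- by move=> i _; split.
Qed.

Lemma measurable_dist_ge {d : nat} (X Y : Omega -> 'rV[R]_d) i delta :
  random_vector X -> random_vector Y ->
  measurable [set w | delta <= `|X w ord0 i - Y w ord0 i|].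
Proof.
move=> /random_vectorP mX /random_vectorP mY.
rewrite (_ : mkset _ = (fun w => `|X w ord0 i - Y w ord0 i|) @^-1` `[delta, +oo[).
  rewrite -[X in measurable X]setTI; apply: measurableT_comp => //.
  exact: measurable_funB.
by apply/seteqP; split => w; rewrite /= in_itv/= andbT.
Qed.

(** If [X] is at most [b] but some coordinate of [Y] exceeds [b + delta], then [X] and [Y] are at
    least [delta] apart there. Used in both directions to sandwich the law of a limit. *)
Lemma le_ray_prob {d : nat} C (X Y : Omega -> 'rV[R]_d) (b : 'I_d -> R) delta :
  measurable C -> random_vector X -> random_vector Y ->
  (P (C `&` [set w | forall i, (X w ord0 i <= b i)%R]) <=
   P (C `&` [set w | forall i, (Y w ord0 i <= b i + delta)%R]) +
   \sum_i P [set w | (delta <= `|X w ord0 i - Y w ord0 i|)%R])%E.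
Proof.
move=> mC rX rY.
have mD i := measurable_dist_ge i delta rX rY.
have mbox (Z : Omega -> 'rV[R]_d) (c : 'I_d -> R) : random_vector Z ->
    measurable (C `&` [set w | forall i, (Z w ord0 i <= c i)%R]).
  move=> /random_vectorP mZ; apply: measurableI => //.
  by apply: (measurable_box (B := fun i => `]-oo, c i]%classic)) => // i;
    exact: measurable_itv.
apply: le_trans (leeD (lexx _) (le_measure_bigsetU mD)).
apply: le_trans (measureU2 _ _ _); last 2 first.
- exact: mbox.
- exact: bigsetU_measurable.
apply: le_measure; rewrite ?inE; [exact: mbox| |].
  by apply: measurableU; [exact: mbox|exact: bigsetU_measurable].
move=> w [Cw Xb].
have [h|/existsNP[i]] := pselect (forall i, Y w ord0 i <= b i + delta).
  by left.
move=> /negP; rewrite -ltNge => Yb; right; rewrite -bigcup_seq/=.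
exists i; first by rewrite /= mem_index_enum.
rewrite /= ler_normr; apply/orP; right; rewrite opprB lerBrDl.
by rewrite (le_trans _ (ltW Yb))// lerD2r Xb.
Qed.

Lemma gauss_indep_rays {d : nat} F (v : R) (X : Omega -> 'rV[R]_d) C (b : 'I_d -> R) :
  F `<=` measurable -> 0 < v -> gauss_indep P F v X -> F C ->
  P (C `&` [set w | forall i, X w ord0 i <= b i]) =
  (fine (P C) * \prod_i normal_cdf (b i / Num.sqrt v))%:E.
Proof.
move=> Fm v0 [_ hX] FC.
have -> : [set w | forall i, X w ord0 i <= b i] =
    [set w | forall i, `]-oo, b i]%classic (X w ord0 i)].
  by apply/seteqP; split => w /= h i; have := h i; rewrite in_itv.
rewrite (hX C FC (fun i => `]-oo, b i]%classic)); last by move=> i;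
  exact: measurable_itv.
rewrite EFinM fineK ?fin_num_measure//; last exact: Fm.
congr (_ * _)%E; rewrite -prodEFin; apply: eq_bigr => i _.
exact: centered_normal_ray.
Qed.

Let cvg_gauss_ray {d : nat} (v_ : nat -> R) (v : R) (b : 'I_d -> R) : 0 < v ->
  v_ n @[n --> \oo] --> v ->
  \prod_i normal_cdf (b i / Num.sqrt (v_ n)) @[n --> \oo] -->
  \prod_i normal_cdf (b i / Num.sqrt v).
Proof.
move=> v0 v_v; apply: cvg_prod_ord => i.
apply: continuous_cvg; first exact: continuous_normal_cdf.
apply: cvgMr; apply: cvgV; first by rewrite gt_eqF ?sqrtr_gt0.
by apply: continuous_cvg => //; exact: sqrt_continuous.
Qed.

Lemma cvg_dist_sum {d : nat} (X_ : nat -> Omega -> 'rV[R]_d) (X :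
  Omega -> 'rV[R]_d) (delta : R) :
  (forall i, P [set w | delta <= `|X_ n w ord0 i - X w ord0 i|]
    @[n --> \oo] --> 0%E) ->
  \sum_i fine (P [set w | delta <= `|X_ n w ord0 i - X w ord0 i|])
    @[n --> \oo] --> (0 : R).
Proof.
move=> h; rewrite [X in _ --> X](_ : 0 = \sum_(i < d) (0 : R)); last by rewrite big1.
suff H (s : seq 'I_d) :
    \sum_(i <- s) fine (P [set w | delta <= `|X_ n w ord0 i - X w ord0 i|])
    @[n --> \oo] --> \sum_(i <- s) (0 : R) by exact: H.
elim: s => [|i s IH].
  by rewrite big_nil; under eq_fun do rewrite big_nil; exact: cvg_cst.
rewrite big_cons; under eq_fun do rewrite big_cons.
by apply: cvgD => //; exact: (fine_cvg (h i)).
Qed.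

(** The ray probabilities of [X] lie between those of [X_ n] at [b - delta] and [b + delta], up to
    an error vanishing with [n]. First [n] tends to infinity, then [delta] to 0; continuity of the
    limit distribution function closes the gap. *)
Lemma gauss_indep_cvg_pos {d : nat} F (v_ : nat -> R) (v : R)
    (X_ : nat -> Omega -> 'rV[R]_d) (X : Omega -> 'rV[R]_d) :
  F `<=` measurable -> 0 < v -> v_ n @[n --> \oo] --> v ->
  (forall n, gauss_indep P F (v_ n) (X_ n)) -> random_vector X ->
  (forall i (delta : R), 0 < delta ->
    P [set w | delta <= `|X_ n w ord0 i - X w ord0 i|] @[n --> \oo] --> 0%E) ->
  gauss_indep P F v X.
Proof.
move=> Fm v0 v_v hX_ rX X_X; split => // C FC B mB.
have mC := Fm _ FC.
pose G := [set A | exists x : R, A = `]-oo, x]%classic].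
apply: (@box_law_ext _ _ _ P _ (measurableTypeR R) (centered_normal v) G
  (fun n => `]-oo, n%:R]%classic) measurable_rays _ _ _ _ C
  (fun i w => X w ord0 i) mC) => //.
- move=> _ _ [x ->] [y ->]; exists (Num.min x y).
  by apply/seteqP; split => z /=; rewrite !in_itv/= le_min => /andP.
- by move=> n; exists n%:R.
- apply/seteqP; split => // x _; exists (Num.truncn `|x|).+1 => //=.
  by rewrite in_itv/= (le_trans (ler_norm _))// ltW// truncnS_gt.
- by apply/random_vectorP.
move=> B' /choice[b Bb].
have -> : [set w | forall i, B' i (X w ord0 i)] =
    [set w | forall i, X w ord0 i <= b i].
  by apply/seteqP; split => w /= h i; have := h i; rewrite Bb/= in_itv.
pose r c := \prod_i normal_cdf ((b i + c) / Num.sqrt v).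
set E := C `&` _.
have mE : measurable E.
  apply: measurableI => //.
  apply: (measurable_box (B := fun i => `]-oo, b i]%classic)) => // i.
  by move/random_vectorP : rX.
have -> : (P C * \prod_i centered_normal v (B' i) = (fine (P C) * r 0)%:E)%E.
  rewrite EFinM fineK ?fin_num_measure//; congr (_ * _)%E.
  rewrite /r -prodEFin; apply: eq_bigr => i _.
  by rewrite Bb addr0; exact: centered_normal_ray.
rewrite -[LHS]fineK ?fin_num_measure//; congr EFin.
have v_gt0 : \forall n \near \oo, 0 < v_ n by apply: (cvgr_gt v).
have mD n i delta := @measurable_dist_ge d _ X i delta (hX_ n).1 rX.
have sumE n (delta : R) : (\sum_i P [set w | (delta <= `|X_ n w ord0 i - X w ord0
  i|)%R] =
    (\sum_i fine (P [set w | delta <= `|X_ n w ord0 i - X w ord0 i|]))%:E)%E.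
  rewrite -sumEFin; apply: eq_bigr => i _; rewrite fineK//.
  exact: fin_num_measure (mD n i delta).
have cvg1 c (delta : R) : 0 < delta ->
  (fine (P C) * \prod_i normal_cdf ((b i + c) / Num.sqrt (v_ n)) +
   \sum_i fine (P [set w | delta <= `|X_ n w ord0 i - X w ord0 i|]))
   @[n --> \oo] --> fine (P C) * r c.
  move=> delta0; rewrite -[X in _ --> X]addr0; apply: cvgD.
    by apply: cvgMr; exact: cvg_gauss_ray.
  by apply: cvg_dist_sum => i; exact: X_X.
have cvg2 c (delta : R) : 0 < delta ->
  (fine (P C) * \prod_i normal_cdf ((b i + c) / Num.sqrt (v_ n)) -
   \sum_i fine (P [set w | delta <= `|X_ n w ord0 i - X w ord0 i|]))
   @[n --> \oo] --> fine (P C) * r c.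
  move=> delta0; rewrite -[X in _ --> X]subr0; apply: cvgB.
    by apply: cvgMr; exact: cvg_gauss_ray.
  by apply: cvg_dist_sum => i; exact: X_X.
have cvg_r (s : R) : fine (P C) * r (s * k.+1%:R^-1) @[k --> \oo] --> fine (P C) * r 0.
  apply: cvgMr; apply: cvg_prod_ord => i.
  apply: continuous_cvg; first exact: continuous_normal_cdf.
  apply: cvgMl; apply: cvgD; first exact: cvg_cst.
  by rewrite -[X in _ --> X](mulr0 s); apply: cvgMr; exact: cvg_harmonic.
apply/eqP; rewrite eq_le; apply/andP; split.
  rewrite -(cvg_lim _ (cvg_r 1))//; apply: limr_ge.
    by apply/cvg_ex; eexists; exact: cvg_r.
  apply: nearW => k; set delta := 1 * _; have delta0 :
    0 < delta by rewrite /delta mul1r.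
  rewrite -(cvg_lim _ (cvg1 delta delta delta0))//; apply: limr_ge.
    by apply/cvg_ex; eexists; exact: cvg1.
  near=> n; rewrite -lee_fin fineK ?fin_num_measure// EFinD -sumE.
  have vn0 : 0 < v_ n by near: n.
  rewrite -(gauss_indep_rays _ Fm vn0 (hX_ n) FC).
  apply: (le_trans (le_ray_prob b delta mC rX (hX_ n).1)).
  rewrite leeD2l//; apply: lee_sum => i _.
  by under eq_set do rewrite distrC.
rewrite -(cvg_lim _ (cvg_r (-1)))//; apply: limr_le.
  by apply/cvg_ex; eexists; exact: cvg_r.
apply: nearW => k; pose delta := k.+1%:R^-1 : R; have delta0 :
  0 < delta by rewrite invr_gt0.
rewrite -(cvg_lim _ (cvg2 (-1 * k.+1%:R^-1) delta delta0))//; apply: limr_le.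
  by apply/cvg_ex; eexists; exact: cvg2.
near=> n; rewrite lerBlDr -lee_fin EFinD fineK ?fin_num_measure// -sumE.
have vn0 : 0 < v_ n by near: n.
rewrite -(gauss_indep_rays _ Fm vn0 (hX_ n) FC).
have -> : E = C `&` [set w | forall i,
    X w ord0 i <= (fun i => b i + -1 * k.+1%:R^-1) i + delta].
  congr (_ `&` _); apply/seteqP; split => w /= h i; have := h i;
  by rewrite mulN1r subrK.
exact: (le_ray_prob _ delta mC (hX_ n).1 rX).
Unshelve. all: by end_near. Qed.

Lemma le_measure_ae (A B : set Omega) : measurable A -> measurable B ->
  {ae P, forall w, A w -> B w} -> (P A <= P B)%E.
Proof.
move=> mA mB [N [mN N0 AB]].
apply: (@le_trans _ _ (P (B `|` N))).
  apply: le_measure; rewrite ?inE//; first exact: measurableU.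
  move=> w Aw; have [Bw|nBw] := pselect (B w); [by left|right].
  by apply: AB => /= /(_ Aw).
have {}N0 : P N = 0%E by exact: N0.
by rewrite -[leRHS]adde0 -N0; exact: measureU2.
Qed.

(** The ray argument would fail at the jump of the Dirac mass. Instead, [|X| >= 2 delta] forces
    [|X_ n| >= delta] or [|X_ n - X| >= delta], and both events become unlikely. *)
Lemma gauss_indep_cvg0 {d : nat} F (v_ : nat -> R)
    (X_ : nat -> Omega -> 'rV[R]_d) (X : Omega -> 'rV[R]_d) :
  F setT -> (forall n, 0 <= v_ n) -> v_ n @[n --> \oo] --> (0 : R) ->
  (forall n, gauss_indep P F (v_ n) (X_ n)) -> random_vector X ->
  (forall i (delta : R), 0 < delta ->
    P [set w | delta <= `|X_ n w ord0 i - X w ord0 i|] @[n --> \oo] --> 0%E) ->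
  {ae P, forall w, X w = 0}.
Proof.
move=> FT v0 v_0 hX_ rX X_X.
have mA (Y : Omega -> 'rV[R]_d) i (a : R) : random_vector Y ->
    measurable [set w | a <= `|Y w ord0 i|].
  move=> /random_vectorP mY.
  rewrite (_ : mkset _ = (fun w => `|Y w ord0 i|) @^-1` `[a, +oo[).
    by rewrite -[X in measurable X]setTI; exact: measurableT_comp.
  by apply/seteqP; split => w; rewrite /= in_itv/= andbT.
have mT (a : R) : measurable [set x : R | a <= `|x|].
  rewrite (_ : mkset _ = Num.norm @^-1` `[a, +oo[).
    by rewrite -[X in measurable X]setTI; exact: normr_measurable.
  by apply/seteqP; split => w; rewrite /= in_itv/= andbT.
have X0 i (delta : R) : 0 < delta -> P [set w | 2 * delta <= `|X w ord0 i|] = 0%E.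
  move=> delta0; apply/eqP; rewrite eq_le measure_ge0 andbT.
  apply/lee_addgt0Pr => e e0; rewrite add0e.
  have e20 : 0 < e / 2 by rewrite divr_gt0.
  have [K K0 NK] := normal_prob_tail e20.
  have dK : 0 < (delta / K) ^+ 2 by rewrite exprn_gt0// divr_gt0.
  have /fine_cvgP[_ /cvgr_lt/(_ _ e20) q_lt] := X_X i delta delta0.
  (* A single index suffices: its variance puts [delta] at least [K] standard deviations away, and
     its distance to [X] is already small. *)
  have [n [vn qn]] : exists n, v_ n < (delta / K) ^+ 2 /\
      fine (P [set w | delta <= `|X_ n w ord0 i - X w ord0 i|]) < e / 2.
    near \oo => n; exists n; split; near: n => //.
    exact: (cvgr_lt 0).
  have mD := @measurable_dist_ge d _ X i delta (hX_ n).1 rX.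
  apply: (@le_trans _ _ (P ([set w | (delta <= `|X_ n w ord0 i|)%R] `|`
      [set w | (delta <= `|X_ n w ord0 i - X w ord0 i|)%R]))).
    apply: le_measure; rewrite ?inE; [exact: mA| |].
      by apply: measurableU => //; apply: mA; exact: (hX_ n).1.
    move=> w /= h; have [|lt1] := leP delta `|X_ n w ord0 i|; first by left.
    right; rewrite /= distrC.
    apply: le_trans (lerB_dist _ _); rewrite lerBrDr.
    by rewrite (le_trans _ h)// mulr2n mulrDl mul1r lerD2l ltW.
  apply: (le_trans (measureU2 _ _ mD)); first by apply: mA; exact: (hX_ n).1.
  rewrite [e in X in (_ <= X)%E](_ : e = e / 2 + e / 2); last by rewrite -splitr.
  rewrite EFinD leeD//; last first.
    by rewrite -[leLHS]fineK ?lee_fin ?ltW// fin_num_measure.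
  apply: (@le_trans _ _ (centered_normal (v_ n) [set x : R | delta <= `|x|])).
    by rewrite -(gauss_indep_marginal i FT (hX_ n) (mT delta)).
  apply: le_trans NK; rewrite /centered_normal /pushforward.
  apply: le_measure; rewrite ?inE; [|exact: mT|].
    rewrite -[X in measurable X]setTI.
    by apply: (@measurable_funM _ _ _ _ (fun=> Num.sqrt (v_ n)) id).
  move=> x /=; rewrite normrM (ger0_norm (sqrtr_ge0 _)) => h.
  have sv : Num.sqrt (v_ n) <= delta / K.
    rewrite -[leRHS]ger0_norm; last by rewrite divr_ge0// ltW.
    by rewrite -sqrtr_sqr ler_sqrt ?ltW.
  have {h} : delta <= delta / K * `|x| by rewrite (le_trans h)// ler_wpM2r.
  by rewrite mulrAC ler_pdivlMr// ler_pM2l.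
(* Only the countably many bounds [2 / (k + 1)] are used, so that the null sets can be united. *)
have Xn0 i : {ae P, forall w, forall k : nat, `|X w ord0 i| < 2 * k.+1%:R^-1}.
  apply: ae_foralln => k; exists [set w | 2 * k.+1%:R^-1 <= `|X w ord0 i|].
  split; [exact: mA|by apply: X0; rewrite invr_gt0|].
  by move=> w /= /negP; rewrite -leNgt.
have : {ae P, forall w, forall i, forall k : nat, `|X w ord0 i| < 2 * k.+1%:R^-1}.
  by apply: filter_forall => i; exact: Xn0.
apply: filterS => w h; apply/rowP => i; rewrite mxE.
apply/eqP/negPn/negP => X0'.
have [k] : exists k : nat, 2 * k.+1%:R^-1 <= `|X w ord0 i|.
  exists (Num.truncn (2 / `|X w ord0 i|)).
  rewrite ler_pdivrMr// mulrC -ler_pdivrMr ?normr_gt0// ltW//.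
  exact: truncnS_gt.
by rewrite leNgt h.
Unshelve. all: by end_near. Qed.

Lemma gauss_indep_ae0 {d : nat} F (X : Omega -> 'rV[R]_d) : F `<=` measurable ->
  random_vector X -> {ae P, forall w, X w = 0} -> gauss_indep P F 0 X.
Proof.
move=> Fm rX X0; split => // C FC B mB.
have [_ h] := @gauss_indep0 _ _ _ P d F Fm.
rewrite -(h C FC B mB); have mC := Fm _ FC.
have mbox (Y : Omega -> 'rV[R]_d) : random_vector Y ->
    measurable (C `&` [set w | forall i, B i (Y w ord0 i)]).
  by move=> /random_vectorP mY; apply: measurableI => //; exact: measurable_box.
have r0 : random_vector (fun _ : Omega => 0 : 'rV[R]_d).
  by have [] := @gauss_indep0 _ _ _ P d F Fm.
apply/eqP; rewrite eq_le; apply/andP; split; apply: le_measure_ae; try exact: mbox.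
  by apply: filterS X0 => w Xw [Cw hw]; split => // i; rewrite /= -Xw; exact: hw.
by apply: filterS X0 => w Xw [Cw hw]; split => // i; rewrite Xw; exact: hw.
Qed.
End gauss_indep_limit.

(** * Wiener integrals *)

Section step_functions.
Context {R : realType}.
Local Notation mu := (@lebesgue_measure R).

Lemma ltr_homo_nat (p : nat -> R) n : (forall k, (k < n)%N -> p k < p k.+1) ->
  forall i j, (i < j)%N -> (j <= n)%N -> p i < p j.
Proof.
move=> p_incr i; elim=> // j IH; rewrite ltnS leq_eqVlt => /orP[/eqP->|ij] jn.
  exact: p_incr.
by rewrite (lt_trans (IH ij (ltnW jn)))// p_incr.
Qed.

Lemma ler_homo_nat (p : nat -> R) n : (forall k, (k < n)%N -> p k < p k.+1) ->
  forall i j, (i <= j)%N -> (j <= n)%N -> p i <= p j.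
Proof.
move=> p_incr i j; rewrite leq_eqVlt => /orP[/eqP->//|ij] jn.
by apply/ltW; exact: (ltr_homo_nat p_incr).
Qed.

(** Each increment telescopes over the cells its entry covers. The values lie in a general module
    because the lemma serves twice: for Brownian paths and, with indicator values, for the step
    function itself. *)
Lemma step_fun_telescope (V : lmodType R) (f : R -> V) (p : nat -> R) n
    (st : seq (R * (R * R))) :
  (forall k, (k < n)%N -> p k < p k.+1) ->
  (forall q, q \in st -> exists i j,
    [/\ (i <= j)%N, (j <= n)%N, q.2.1 = p i & q.2.2 = p j]) ->
  \sum_(q <- st) q.1 *: (f q.2.1 - f q.2.2) =
  \sum_(k < n) step_fun st (p k) *: (f (p k) - f (p k.+1)).
Proof.
move=> p_incr st_p.
under [RHS]eq_bigr do rewrite scaler_suml.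
rewrite exchange_big/=; apply: eq_big_seq => q qst.
have [i [j [ij jn -> ->]]] := st_p q qst.
under eq_bigr do rewrite -scalerA; rewrite -scaler_sumr; congr (_ *: _).
rewrite -(big_mkord predT (fun k => \1_(`[p i, p j[%classic : set R) (p k) *:
  (f (p k) - f (p k.+1)))).
(* The indicator at [p k] is 1 exactly for [i <= k < j]; the blocks before and after vanish. *)
rewrite (big_cat_nat (n := i))//=; last exact: leq_trans jn.
rewrite (big_cat_nat (n := j) (m := i))//=.
rewrite big_nat_cond big1 ?add0r; last first.
  move=> k; rewrite andbT => /= ki; rewrite indicE memNset ?scale0r//=.
  rewrite in_itv/= leNgt (ltr_homo_nat p_incr)//.
  exact: leq_trans jn.
rewrite [X in _ = _ + X]big_nat_cond [X in _ = _ + X]big1 ?addr0; last first.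
  move=> k; rewrite andbT => /= /andP[jk kn]; rewrite indicE memNset ?scale0r//=.
  by rewrite in_itv/= ltNge (ler_homo_nat p_incr jk (ltnW kn)) andbF.
rewrite -[LHS]opprB -(telescope_sumr (fun k => f (p k)) ij) -sumrN.
rewrite [LHS]big_nat_cond [RHS]big_nat_cond; apply: eq_bigr => k.
rewrite andbT => /andP[ik kj]; rewrite opprB indicE mem_set ?scale1r//=.
have kn := leq_trans (ltnW kj) jn.
by rewrite in_itv/= (ler_homo_nat p_incr)// (ltr_homo_nat p_incr).
Qed.

Definition step_entries_in (a b : R) (st : seq (R * (R * R))) :=
  forall q, q \in st -> a <= q.2.1 /\ q.2.1 <= q.2.2 /\ q.2.2 <= b.

(** Entries may overlap. Cutting at all their endpoints gives disjoint cells, over which Brownian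
    increments are independent. *)
Lemma step_partition a b (st : seq (R * (R * R))) : a <= b ->
  step_entries_in a b st ->
  exists (p : nat -> R) n,
  [/\ forall k, (k < n)%N -> p k < p k.+1, a <= p 0%N, p n <= b &
   forall q, q \in st -> exists i j,
    [/\ (i <= j)%N, (j <= n)%N, q.2.1 = p i & q.2.2 = p j]].
Proof.
move=> ab st_ab.
(* Including [a] keeps the list nonempty even when [st] is empty. *)
pose s0 := a :: flatten [seq [:: q.2.1; q.2.2] | q <- st].
pose s := sort <=%R (undup s0).
have s_lt : sorted <%R s by rewrite sort_lt_sorted undup_uniq.
have mem_s x : (x \in s) = (x \in s0) by rewrite mem_sort mem_undup.
have s_ab x : x \in s -> a <= x <= b.
  rewrite mem_s inE => /orP[/eqP->|]; first by rewrite lexx.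
  move=> /flatten_mapP[q /st_ab[aq [qq qb]]]; rewrite !inE => /orP[]/eqP->.
    by rewrite aq (le_trans qq).
  by rewrite qb (le_trans aq).
have s_gt0 : (0 < size s)%N.
  by have : a \in s by [rewrite mem_s inE eqxx]; case: s {s_lt mem_s s_ab}.
exists (nth 0 s), (size s).-1; split.
- move=> k kn; apply: (sorted_ltn_nth lt_trans) => //; rewrite inE.
    by rewrite (ltn_trans kn)// ltn_predL.
  by rewrite -ltn_predRL.
- by have /andP[] := s_ab _ (mem_nth 0 s_gt0).
- by have /s_ab/andP[] : nth 0 s (size s).-1 \in s by rewrite mem_nth// ltn_predL.
- move=> q qst.
  have m1 : q.2.1 \in s.
    rewrite mem_s inE; apply/orP; right; apply/flatten_mapP.
    by exists q => //; rewrite !inE eqxx.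
  have m2 : q.2.2 \in s.
    rewrite mem_s inE; apply/orP; right; apply/flatten_mapP.
    by exists q => //; rewrite !inE eqxx orbT.
  exists (index q.2.1 s), (index q.2.2 s); split; rewrite ?nth_index//.
    rewrite leqNgt; apply/negP => h.
    have := sorted_ltn_nth lt_trans 0 s_lt; move=> /(_ _ _ _ _ h).
    rewrite !inE !index_mem !nth_index// => /(_ m2 m1).
    by rewrite ltNge; have [_ [->]] := st_ab q qst.
  by rewrite -ltnS prednK// index_mem.
Qed.

Lemma sqr_sum_cells (p : nat -> R) n (c : nat -> R) x :
  (forall k, (k < n)%N -> p k <= p k.+1) ->
  (\sum_(k < n) c k * \1_(`[p k, p k.+1[%classic : set R) x) ^+ 2 =
  \sum_(k < n) c k ^+ 2 * \1_(`[p k, p k.+1[%classic : set R) x.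
Proof.
move=> p_nd.
(* The induction also carries that the sum vanishes from [p n] on, which removes the cross term with
   the next cell. *)
suff [] : (\sum_(k < n) c k * \1_(`[p k, p k.+1[%classic : set R) x) ^+ 2 =
    \sum_(k < n) c k ^+ 2 * \1_(`[p k, p k.+1[%classic : set R) x /\
   (p n <= x -> \sum_(k < n) c k * \1_(`[p k, p k.+1[%classic : set R) x = 0) by [].
elim: n p_nd => [|n IH] p_nd; first by rewrite !big_ord0 expr0n/=.
have {IH}[IH1 IH2] := IH (fun k kn => p_nd k (ltnW kn)).
rewrite !big_ord_recr/= indicE.
have [/set_mem/=|xn] := boolP (x \in _).
  rewrite in_itv/= => /andP[px xp]; rewrite sqrrD IH1 IH2// mul0r mul0rn addr0.
  by rewrite !mulr1; split => //; rewrite leNgt xp.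
rewrite !mulr0 !addr0; split => // px; apply: IH2.
by rewrite (le_trans _ px)// p_nd.
Qed.

Lemma step_fun_cells (p : nat -> R) n (st : seq (R * (R * R))) x :
  (forall k, (k < n)%N -> p k < p k.+1) ->
  (forall q, q \in st -> exists i j,
    [/\ (i <= j)%N, (j <= n)%N, q.2.1 = p i & q.2.2 = p j]) ->
  step_fun st x =
  \sum_(k < n) step_fun st (p k) * \1_(`[p k, p k.+1[%classic : set R) x.
Proof.
move=> p_incr st_p.
have ind (l r : R) : l <= r -> \1_(`[l, r[%classic : set R) x =
    (l <= x)%R%:R - (r <= x)%R%:R :> R.
  move=> lr; rewrite indicE; have [/set_mem/=|/negP] := boolP (x \in _).
    by rewrite in_itv/= => /andP[-> xr]; rewrite leNgt xr subr0.
  move=> h; have {h} : ~ (l <= x < r) by move=> h'; apply: h; rewrite inE/= in_itv.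
  have [lx|xl] := leP l x; have [rx|xr] := leP r x => //=.
  - by rewrite subrr.
  - by move=> h; have := lt_le_trans xl lr; rewrite ltNge rx.
  - by rewrite subrr.
(* The indicator of [[l, r[] at [x] is the increment of [y] mapped to the truth value of [y <= x],
   so the telescoping lemma applies. *)
have := @step_fun_telescope R^o (fun y => (y <= x)%R%:R) p n st p_incr st_p.
move=> h; transitivity (\sum_(q <- st) q.1 *: ((q.2.1 <= x)%R%:R - (q.2.2 <= x)%R%:R
  : R^o)).
  rewrite /step_fun; apply: eq_big_seq => q /st_p[i [j [ij jn qi qj]]].
  by rewrite ind// qi qj (ler_homo_nat p_incr).
rewrite h; apply: eq_bigr => k _; rewrite ind//.
exact/ltW/p_incr.
Qed.

Lemma integral_cells (a b : R) (p : nat -> R) n (c : nat -> R) :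
  (forall k, (k < n)%N -> p k <= p k.+1) ->
  (forall k, (k <= n)%N -> a <= p k <= b) ->
  (forall k, 0 <= c k) ->
  (\int[mu]_(x in `[a, b]) (\sum_(k < n) c k * \1_(`[p k, p k.+1[%classic :
    set R) x)%:E)%E =
  (\sum_(k < n) c k * (p k.+1 - p k))%:E.
Proof.
move=> p_nd p_ab c0; under eq_integral do rewrite -sumEFin.
rewrite ge0_integral_sum//; first last.
- by move=> k x _; rewrite lee_fin mulr_ge0// indicE.
- by move=> k; apply/measurable_EFinP/measurable_funM.
rewrite -sumEFin; apply: eq_bigr => k _.
under eq_integral do rewrite EFinM.
rewrite ge0_integralZl//; first last.
- by rewrite lee_fin.
- by apply/measurable_EFinP/measurable_funTS; exact: measurable_indic.
rewrite integral_indic//= EFinM; congr (_ * _)%E.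
rewrite setIidl; last first.
  move=> x /=; rewrite !in_itv/= => /andP[px xp].
  have /andP[ap _] := p_ab k (ltnW (ltn_ord k)).
  have /andP[_ pb] := p_ab k.+1 (ltn_ord k).
  by rewrite (le_trans ap)// (le_trans _ pb)// ltW.
rewrite lebesgue_measure_itv/= lte_fin; case: ifPn; first by rewrite EFinB.
by rewrite -leNgt => h; have /eqP -> : p k.+1 == p k;
  [rewrite eq_le h p_nd|rewrite subrr].
Qed.
End step_functions.

Section gauss_indep_limit_any.
Context {dO : measure_display} {Omega : measurableType dO} {R : realType}.
Variable P : probability Omega R.

Lemma gauss_indep_cvg {d : nat} (F : set_system Omega) (v_ : nat -> R) (v : R)
    (X_ : nat -> Omega -> 'rV[R]_d) (X : Omega -> 'rV[R]_d) :
  F setT -> F `<=` measurable -> (forall n, 0 <= v_ n) -> 0 <= v ->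
  v_ n @[n --> \oo] --> v ->
  (forall n, gauss_indep P F (v_ n) (X_ n)) -> random_vector X ->
  (forall i (delta : R), 0 < delta ->
    P [set w | delta <= `|X_ n w ord0 i - X w ord0 i|] @[n --> \oo] --> 0%E) ->
  gauss_indep P F v X.
Proof.
move=> FT Fm v_0 v0 v_v hX_ rX X_X.
have [v_eq0|vn0] := eqVneq v 0; last first.
  by apply: (gauss_indep_cvg_pos Fm _ v_v hX_ rX X_X); rewrite lt_def vn0.
rewrite v_eq0 in v_v *.
exact: (gauss_indep_ae0 Fm rX (gauss_indep_cvg0 FT v_0 v_v hX_ rX X_X)).
Qed.

Lemma gauss_indep_0_ae {d : nat} (F : set_system Omega) (X : Omega -> 'rV[R]_d) :
  F setT -> gauss_indep P F 0 X -> {ae P, forall w, X w = 0}.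
Proof.
move=> FT gX.
apply: (gauss_indep_cvg0 (P := P) FT (v_ := fun=> 0) (X_ := fun=> X)) => //.
- exact: cvg_cst.
- exact: gX.1.
move=> i delta delta0; rewrite (_ : mkset _ = set0) ?measure0; first exact: cvg_cst.
by apply/seteqP; split => w //=; rewrite subrr normr0 leNgt delta0.
Qed.
End gauss_indep_limit_any.

(** * Brownian increments and integrals of step functions *)

Section brownian_steps.
Context {dO : measure_display} {Omega : measurableType dO} {R : realType}.
Variable P : probability Omega R.
Context {d : nat}.
Variables (a b : R) (F : R -> set_system Omega) (W : R -> Omega -> 'rV[R]_d).
Hypotheses (hF : reverse_filtration a b F) (hW : reverse_brownian P a b F W).
Local Notation mu := (@lebesgue_measure R).

Lemma sigma_of_lin (G : set_system Omega) (X Y : Omega -> 'rV[R]_d) k l :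
  sigma_algebra setT G -> sigma_of X `<=` G -> sigma_of Y `<=` G ->
  sigma_of (fun w => k *: X w + l *: Y w) `<=` G.
Proof.
move=> sG XG YG; apply: sigma_of_sub => // i A mA.
pose S := g_sigma_algebraType G.
have mS (Z : Omega -> 'rV[R]_d) : sigma_of Z `<=` G ->
    measurable_fun setT (fun w : S => Z w ord0 i).
  move=> ZG _ B mB; rewrite setTI; apply: sub_sigma_algebra; apply: ZG.
  exact: sigma_of_coord.
have : measurable_fun setT (fun w : S => k * X w ord0 i + l * Y w ord0 i).
  by apply: measurable_funD; apply: measurable_funM => //; exact: mS.
move=> /(_ measurableT A mA); rewrite setTI.
rewrite -[G in X in _ -> X](sigma_algebra_id sG).
rewrite [X in _ -> _ X](_ : _ = (fun w : S => k * X w ord0 i + l * Y w ord0 i) @^-1`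
  A)//.
by apply/seteqP; split => w /=; rewrite !mxE.
Qed.

Lemma brownian_increment s r : a <= s -> s < r -> r <= b ->
  gauss_indep P (F r) (r - s) (fun w => W s w - W r w).
Proof.
move=> as_ sr rb; have [_ _ /(_ s r as_ sr rb)[[rX hX] hi]] := hW.
split => // C FC B mB; rewrite setIC hi//; last exact: sigma_of_box.
rewrite (hX B mB) muleC; congr (_ * _)%E; apply: eq_bigr => i _.
by rewrite (centered_normalE _ (mB i)) ?subr_gt0.
Qed.

Lemma brownian_increment_sub s r q : a <= s -> s <= r -> r <= b ->
  q <= s -> a <= q -> sigma_of (fun w => W s w - W r w) `<=` F q.
Proof.
move=> as_ sr rb qs aq; have [adW _ _] := hW; have [hF1 hF2] := hF.
have qb : q <= b by rewrite (le_trans qs)// (le_trans sr).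
rewrite (_ : (fun w => _) = (fun w => 1 *: W s w + (-1) *: W r w)); last first.
  by apply/funext => w; rewrite scale1r scaleN1r.
apply: sigma_of_lin; first by apply: (hF1 q _).1; rewrite aq.
- apply: (subset_trans (adW s _)); first by rewrite as_ (le_trans sr).
  by apply: hF2 => //; rewrite (le_trans sr).
- apply: (subset_trans (adW r _)); first by rewrite (le_trans as_).
  by apply: hF2 => //; rewrite (le_trans qs).
Qed.

(** Time runs backwards, so the newest information sits at [p 0]. The first increment is independent
    of [F (p 1)], and the remaining sum is measurable for it; the second conclusion carries this
    measurability through the induction. *)
Lemma brownian_sum_gauss n : forall (p c : nat -> R),
  (forall k, (k < n)%N -> p k < p k.+1) -> a <= p 0%N -> p n <= b ->
  let S := fun w => \sum_(k < n) c k *: (W (p k) w - W (p k.+1) w) in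
  gauss_indep P (F b) (\sum_(k < n) c k ^+ 2 * (p k.+1 - p k)) S /\
  sigma_of S `<=` F (p 0%N).
Proof.
have [hF1 hF2] := hF.
elim: n => [|n IH] p c p_incr ap pb S.
  have ab : a <= b by rewrite (le_trans ap).
  have -> : S = fun=> 0 by apply/funext => w; rewrite /S big_ord0.
  rewrite big_ord0; split.
    by apply: gauss_indep0; apply: (hF1 b _).2; rewrite ab lexx.
  have sF := (hF1 (p 0%N) (introT andP (conj ap pb))).1.
  apply: sigma_of_sub => // i A mA.
  have [A0|A0] := pselect (A 0).
    rewrite (_ : _ @^-1` _ = setT); first exact: sigma_algebraT.
    by apply/seteqP; split => w //= _; rewrite mxE.
  rewrite (_ : _ @^-1` _ = set0); first by case: sF.
  by apply/seteqP; split => w //=; rewrite mxE.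
have p01 := p_incr 0%N isT.
have p1n : p 1%N <= p n.+1 by apply: (ler_homo_nat p_incr).
have p1b : p 1%N <= b by exact: le_trans pb.
have ap1 : a <= p 1%N by rewrite (le_trans ap)// ltW.
have [gY YF] := IH (p \o succn) (c \o succn) (fun k kn => p_incr k.+1 kn) ap1 pb.
have SE : S = fun w => c 0%N *: (W (p 0%N) w - W (p 1%N) w) +
    \sum_(k < n) c k.+1 *: (W (p k.+1) w - W (p k.+2) w).
  by apply/funext => w; rewrite /S big_ord_recl.
rewrite big_ord_recl/= SE.
have p1ab : a <= p 1%N <= b by rewrite ap1.
have inc := brownian_increment ap p01 p1b.
split.
  apply: (@gauss_indepD _ _ _ P d (F b) (F (p 1%N))).
  - exact: (hF1 _ p1ab).1.
  - exact: hF2.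
  - exact: (hF1 _ p1ab).2.
  - by rewrite mulr_ge0 ?sqr_ge0// subr_ge0 ltW.
  - apply: sumr_ge0 => k _; rewrite mulr_ge0 ?sqr_ge0// subr_ge0 ltW//.
    by apply: p_incr; rewrite ltnS; case: k.
  - by apply: gauss_indepZ => //; rewrite subr_ge0 ltW.
  - exact: gY.
  - exact: YF.
have ap0b : a <= p 0%N <= b by rewrite ap (le_trans (ltW p01)).
rewrite (_ : (fun w => _) = (fun w => c 0%N *: (W (p 0%N) w - W (p 1%N) w) +
    1 *: \sum_(k < n) c k.+1 *: (W (p k.+1) w - W (p k.+2) w))); last first.
  by apply/funext => w; rewrite scale1r.
apply: sigma_of_lin; first exact: (hF1 _ ap0b).1.
  by apply: brownian_increment_sub => //; exact: ltW.
by apply: (subset_trans YF) => /=; apply: hF2 => //; exact: ltW.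
Qed.

(** The Ito isometry for step functions: on disjoint cells the variance of the sum is the integral
    of the square. *)
Lemma step_int_gauss (st : seq (R * (R * R))) : a <= b ->
  step_entries_in a b st ->
  exists v : R, [/\ 0 <= v,
   (\int[mu]_(x in `[a, b]) (step_fun st x ^+ 2)%:E)%E = v%:E &
   gauss_indep P (F b) v (step_int W st)].
Proof.
move=> ab st_ab.
have [p [n [p_incr ap pb st_p]]] := step_partition ab st_ab.
exists (\sum_(k < n) step_fun st (p k) ^+ 2 * (p k.+1 - p k)); split.
- apply: sumr_ge0 => k _; rewrite mulr_ge0 ?sqr_ge0// subr_ge0 ltW//.
  exact: p_incr.
- under eq_integral.
    move=> x _; rewrite (step_fun_cells x p_incr st_p).
    rewrite (sqr_sum_cells (fun k => step_fun st (p k))); last first.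
      by move=> k /p_incr/ltW.
    over.
  apply: (integral_cells (c := fun k => step_fun st (p k) ^+ 2)).
  - by move=> k /p_incr/ltW.
  - move=> k kn; rewrite (le_trans ap) ?(le_trans _ pb)//.
      exact: (ler_homo_nat p_incr).
    exact: (ler_homo_nat p_incr).
  - by move=> k; exact: sqr_ge0.
have [gS _] := brownian_sum_gauss (fun k => step_fun st (p k)) p_incr ap pb.
rewrite (_ : step_int W st = fun w => \sum_(k < n) step_fun st (p k) *:
  (W (p k) w - W (p k.+1) w))//.
by apply/funext => w; exact: (step_fun_telescope (W^~ w) p_incr st_p).
Qed.
End brownian_steps.

(** * Quadratic estimates in L2 *)

Section L2.
Context {d : measure_display} {T : measurableType d} {R : realType}.
Variables (mu : {measure set T -> \bar R}) (D : set T).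
Hypothesis mD : measurable D.

Lemma measurable_sqr (f : T -> R) : measurable_fun D f ->
  measurable_fun D (fun x => (f x ^+ 2)%:E).
Proof. by move=> mf; apply/measurable_EFinP; exact: measurable_funX. Qed.

Lemma integral_sqr_ge0 (f : T -> R) : (0 <= \int[mu]_(x in D) (f x ^+ 2)%:E)%E.
Proof. by apply: integral_ge0 => x _; rewrite lee_fin sqr_ge0. Qed.

Lemma le_integral_sqr_lin (f g : T -> R) (k l : R) :
  measurable_fun D f -> measurable_fun D g ->
  (\int[mu]_(x in D) ((k * f x + l * g x) ^+ 2)%:E <=
   (2 * k ^+ 2)%:E * \int[mu]_(x in D) (f x ^+ 2)%:E +
   (2 * l ^+ 2)%:E * \int[mu]_(x in D) (g x ^+ 2)%:E)%E.
Proof.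
move=> mf mg.
have k2 : 0 <= 2 * k ^+ 2 by rewrite mulr_ge0 ?sqr_ge0.
have l2 : 0 <= 2 * l ^+ 2 by rewrite mulr_ge0 ?sqr_ge0.
rewrite -!ge0_integralZl//; try by [move=> x _; rewrite lee_fin sqr_ge0|
  exact: measurable_sqr|rewrite lee_fin mulr_ge0 ?sqr_ge0].
rewrite -ge0_integralD//; try by [move=> x _; rewrite -EFinM lee_fin
   mulr_ge0 ?sqr_ge0|apply: emeasurable_funM => //; exact: measurable_sqr].
apply: ge0_le_integral => //.
- by move=> x _; rewrite lee_fin sqr_ge0.
- apply: (measurable_sqr (f := fun x => k * f x + l * g x)).
  by apply: measurable_funD; exact: measurable_funM.
- by apply: emeasurable_funD; apply: emeasurable_funM => //; exact: measurable_sqr.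
move=> x _; rewrite -!EFinM -EFinD lee_fin.
have := sqr_ge0 (k * f x - l * g x); nra.
Qed.

Lemma cvg_integral_sqr_lin (f_ g_ : nat -> T -> R) (k l : R) :
  (forall n, measurable_fun D (f_ n)) -> (forall n, measurable_fun D (g_ n)) ->
  (\int[mu]_(x in D) (f_ n x ^+ 2)%:E)%E @[n --> \oo] --> 0%E ->
  (\int[mu]_(x in D) (g_ n x ^+ 2)%:E)%E @[n --> \oo] --> 0%E ->
  (\int[mu]_(x in D) ((k * f_ n x + l * g_ n x) ^+ 2)%:E)%E @[n --> \oo] --> 0%E.
Proof.
move=> mf mg f0 g0.
apply: (squeeze_cvge (f := fun=> 0%E) (h := fun n =>
  ((2 * k ^+ 2)%:E * \int[mu]_(x in D) (f_ n x ^+ 2)%:E +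
   (2 * l ^+ 2)%:E * \int[mu]_(x in D) (g_ n x ^+ 2)%:E)%E)).
- apply: nearW => n; rewrite integral_sqr_ge0/=.
  exact: le_integral_sqr_lin.
- exact: cvg_cst.
rewrite -[X in _ --> X]adde0; apply: cvgeD => //.
  by rewrite -[X in _ --> X](mule0 (2 * k ^+ 2)%:E); apply: cvgeZl.
by rewrite -[X in _ --> X](mule0 (2 * l ^+ 2)%:E); apply: cvgeZl.
Qed.

(** Instead of the triangle inequality for norms, a weighted Young inequality with parameter [th] is
    used in both directions; [th] is fixed before [n] grows. *)
Lemma cvg_L2_norm (h : T -> R) (s_ : nat -> T -> R) (v_ : nat -> R) (V : R) :
  measurable_fun D h -> (forall n, measurable_fun D (s_ n)) ->
  (\int[mu]_(x in D) (h x ^+ 2)%:E = V%:E)%E ->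
  (forall n, \int[mu]_(x in D) (s_ n x ^+ 2)%:E = (v_ n)%:E)%E ->
  (\int[mu]_(x in D) ((h x - s_ n x) ^+ 2)%:E)%E @[n --> \oo] --> 0%E ->
  v_ n @[n --> \oo] --> V.
Proof.
move=> mh ms hV sv q0.
have V0 : 0 <= V by rewrite -lee_fin -hV integral_sqr_ge0.
have q_fin n : (\int[mu]_(x in D) ((h x - s_ n x) ^+ 2)%:E \is a fin_num)%E.
  rewrite ge0_fin_numE ?integral_sqr_ge0//.
  apply: (@le_lt_trans _ _ ((2 * 1 ^+ 2)%:E * V%:E + (2 * (-1) ^+ 2)%:E * (v_ n)%:E)%E).
    rewrite -hV -sv; have := @le_integral_sqr_lin h (s_ n) 1 (-1) mh (ms n).
    by under eq_integral do rewrite mul1r mulN1r.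
  by rewrite -!EFinM -EFinD ltry.
pose q n := fine (\int[mu]_(x in D) ((h x - s_ n x) ^+ 2)%:E)%E.
have qE n : (\int[mu]_(x in D) ((h x - s_ n x) ^+ 2)%:E)%E = (q n)%:E.
  by rewrite /q fineK.
have {q0} q_cvg : q n @[n --> \oo] --> (0 : R) by exact: (fine_cvg q0).
have bound (f g : T -> R) (th : R) : 0 < th ->
    measurable_fun D f -> measurable_fun D g ->
   (\int[mu]_(x in D) (f x ^+ 2)%:E <=
    (1 + th)%:E * \int[mu]_(x in D) (g x ^+ 2)%:E
     + (1 + th^-1)%:E * \int[mu]_(x in D) ((f x - g x) ^+ 2)%:E)%E.
  move=> th0 mf mg.
  have mfg : measurable_fun D (fun x => f x - g x) by exact: measurable_funB.
  have th1 : 0 <= 1 + th by rewrite addr_ge0// ltW.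
  have th2 : 0 <= 1 + th^-1 by rewrite addr_ge0// ltW// invr_gt0.
  rewrite -ge0_integralZl//; [|exact: measurable_sqr|
    by move=> x _; rewrite lee_fin sqr_ge0].
  rewrite -ge0_integralZl//; [|exact: measurable_sqr|
    by move=> x _; rewrite lee_fin sqr_ge0].
  rewrite -ge0_integralD//; first last.
  - by apply: emeasurable_funM => //; exact: measurable_sqr.
  - by move=> x _; rewrite mule_ge0// lee_fin sqr_ge0.
  - by apply: emeasurable_funM => //; exact: measurable_sqr.
  - by move=> x _; rewrite mule_ge0// lee_fin sqr_ge0.
  apply: ge0_le_integral => //.
  - by move=> x _; rewrite lee_fin sqr_ge0.
  - exact: measurable_sqr.
  - by apply: emeasurable_funD; apply: emeasurable_funM => //; exact: measurable_sqr.
  move=> x _; rewrite -!EFinM -EFinD lee_fin -subr_ge0.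
  rewrite [leRHS](_ : _ = (th * g x - (f x - g x)) ^+ 2 / th); last first.
    by field; rewrite gt_eqF.
  by rewrite divr_ge0 ?sqr_ge0// ltW.
have up n (th : R) : 0 < th -> v_ n <= (1 + th) * V + (1 + th^-1) * q n.
  move=> th0; have := bound (s_ n) h th th0 (ms n) mh.
  rewrite sv hV; under [X in (_ <= _ + _ * X)%E]eq_integral do rewrite -sqrrN opprB.
  by rewrite qE -!EFinM -EFinD lee_fin.
have lo n (th : R) : 0 < th -> V <= (1 + th) * v_ n + (1 + th^-1) * q n.
  move=> th0; have := bound h (s_ n) th th0 mh (ms n).
  by rewrite sv hV qE -!EFinM -EFinD lee_fin.
apply/cvgrPdist_le => e e0.
(* The number [2 * V + 1] will bound both [V] and [v_ n], so the terms carrying [th] cost at most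
   [e / 2]. *)
pose th := Num.min 1 (e / 2 / (2 * V + 1)).
have V1 : 0 < 2 * V + 1 by rewrite ltr_wpDl// mulr_ge0.
have th0 : 0 < th by rewrite lt_min ltr01/= !divr_gt0.
have th1 : th <= 1 by rewrite ge_min lexx.
have thV : th * (2 * V + 1) <= e / 2.
  by rewrite -ler_pdivlMr// ge_min lexx orbT.
have c0 : 0 < 1 + th^-1 by rewrite addr_gt0// invr_gt0.
near=> n.
have q1 : (1 + th^-1) * q n <= Num.min 1 (e / 2).
  rewrite mulrC -ler_pdivlMr//; near: n; apply: (cvgr_le 0) => //.
  by rewrite divr_gt0// lt_min ltr01 divr_gt0.
have /andP[q2 q3] : ((1 + th^-1) * q n <= 1) && ((1 + th^-1) * q n <= e / 2).
  by move: q1; rewrite le_min.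
have u := up n _ th0; have l := lo n _ th0.
have vV : v_ n <= 2 * V + 1 by nra.
rewrite ler_norml; apply/andP; split; nra.
Unshelve. all: by end_near. Qed.
End L2.

(** * Gaussian law of Wiener integrals *)

Section ito_class.
Context {dO : measure_display} {Omega : measurableType dO} {R : realType}.
Variable P : probability Omega R.
Context {d : nat}.
Variables (a b : R) (F : R -> set_system Omega) (W : R -> Omega -> 'rV[R]_d).
Hypothesis ab : a <= b.
Hypotheses (hF : reverse_filtration a b F) (hW : reverse_brownian P a b F W).
Local Notation mu := (@lebesgue_measure R).

(** The graph of the Wiener integral on [[a, b]], as the L2-closure of its
    restriction to step functions. *)
Definition wiener_graph (h : R -> R) (X : Omega -> 'rV[R]_d) :=
  exists st : nat -> seq (R * (R * R)),
    [/\ forall n, step_entries_in a b (st n),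
        (\int[mu]_(x in `[a, b]) ((h x - step_fun (st n) x) ^+ 2)%:E)%E
          @[n --> \oo] --> 0%E &
        forall i, (\int[P]_w ((X w ord0 i - step_int W (st n) w ord0 i) ^+ 2)%:E)%E
          @[n --> \oo] --> 0%E].

Definition scale_steps (k : R) (st : seq (R * (R * R))) :=
  [seq (k * q.1, q.2) | q <- st].

Lemma step_fun_lin k l st1 st2 x :
  step_fun (scale_steps k st1 ++ scale_steps l st2) x =
  k * step_fun st1 x + l * step_fun st2 x.
Proof.
rewrite /step_fun big_cat/= !big_map !mulr_sumr.
by congr (_ + _); apply: eq_bigr => q _; rewrite mulrA.
Qed.

Lemma step_int_lin k l st1 st2 w :
  step_int W (scale_steps k st1 ++ scale_steps l st2) w =
  k *: step_int W st1 w + l *: step_int W st2 w.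
Proof.
rewrite /step_int big_cat/= !big_map !scaler_sumr.
by congr (_ + _); apply: eq_bigr => q _; rewrite scalerA.
Qed.

Lemma step_entries_in_lin k l st1 st2 :
  step_entries_in a b st1 -> step_entries_in a b st2 ->
  step_entries_in a b (scale_steps k st1 ++ scale_steps l st2).
Proof.
move=> h1 h2 q; rewrite mem_cat => /orP[]/mapP[q' q'st ->] /=; [exact: h1|exact: h2].
Qed.

Lemma measurable_step_fun D st : measurable_fun D (@step_fun R st).
Proof.
apply: measurable_funTS; elim: st => [|q st IH].
  rewrite (_ : step_fun [::] = fun=> 0); first exact: measurable_cst.
  by apply/funext => x; rewrite /step_fun big_nil.
rewrite (_ : step_fun (q :: st) = fun x => q.1 *
    \1_(`[q.2.1, q.2.2[%classic : set R) x + step_fun st x); last first.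
  by apply/funext => x; rewrite /step_fun big_cons.
by apply: measurable_funD => //; apply: measurable_funM.
Qed.

Lemma measurable_step_int st i : step_entries_in a b st ->
  measurable_fun setT (fun w => step_int W st w ord0 i).
Proof.
move=> h; have [v [_ _ [rS _]]] := step_int_gauss hF hW ab h.
by move: i; apply/random_vectorP.
Qed.

(** Concatenating scaled step lists approximates the combination, so integrals with unrelated
    approximating sequences can be combined. *)
Lemma wiener_graph_lin (h h' : R -> R) (X X' : Omega -> 'rV[R]_d) (k l : R) :
  measurable_fun `[a, b] h -> measurable_fun `[a, b] h' ->
  random_vector X -> random_vector X' ->
  wiener_graph h X -> wiener_graph h' X' ->
  wiener_graph (fun x => k * h x + l * h' x) (fun w => k *: X w + l *: X' w).
Proof.
move=> mh mh' /random_vectorP rX /random_vectorP rX'.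
move=> [st [st_ab st_h st_X]] [st' [st'_ab st'_h st'_X]].
exists (fun n => scale_steps k (st n) ++ scale_steps l (st' n)); split.
- by move=> n; exact: step_entries_in_lin.
- have := @cvg_integral_sqr_lin _ _ _ mu _ (measurable_itv `[a, b])
    (fun n x => h x - step_fun (st n) x) (fun n x => h' x - step_fun (st' n) x)
    k l _ _ st_h st'_h.
  rewrite [X in _ -> _ -> (X @ _ --> _)](_ : _ = (fun n => \int[mu]_(x in `[a, b])
      ((k * h x + l * h' x - step_fun (scale_steps k (st n) ++ scale_steps l (st' n))
        x) ^+ 2)%:E)%E).
    apply => //.
    + by move=> n; apply: measurable_funB => //; exact: measurable_step_fun.
    + by move=> n; apply: measurable_funB => //; exact: measurable_step_fun.
  apply/funext => n; apply: eq_integral => x _; rewrite step_fun_lin.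
  by congr (_ ^+ 2)%:E; ring.
- move=> i; have := @cvg_integral_sqr_lin _ _ _ P _ measurableT
    (fun n w => X w ord0 i - step_int W (st n) w ord0 i)
    (fun n w => X' w ord0 i - step_int W (st' n) w ord0 i)
    k l _ _ (st_X i) (st'_X i).
  rewrite [X in _ -> _ -> (X @ _ --> _)](_ : _ = (fun n => \int[P]_w
      (((k *: X w + l *: X' w) ord0 i -
       step_int W (scale_steps k (st n) ++ scale_steps l (st' n)) w ord0 i) ^+
         2)%:E)%E).
    apply => //.
    + by move=> n; apply: measurable_funB => //; exact: measurable_step_int.
    + by move=> n; apply: measurable_funB => //; exact: measurable_step_int.
  apply/funext => n; apply: eq_integral => w _; rewrite step_int_lin !mxE.
  by congr (_ ^+ 2)%:E; ring.
Qed.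

Lemma wiener_graph0 : wiener_graph (fun=> 0) (fun=> 0).
Proof.
exists (fun=> [::]); split => //.
- rewrite (_ : (fun n : nat => _) = fun=> 0%E); first exact: cvg_cst.
  apply/funext => n; apply: integral0_eq => x _.
  by rewrite /step_fun big_nil subrr expr0n.
- move=> i; rewrite (_ : (fun n : nat => _) = fun=> 0%E); first exact: cvg_cst.
  apply/funext => n; apply: integral0_eq => x _.
  by rewrite /step_int big_nil mxE subrr expr0n.
Qed.

Lemma wiener_graph_gauss (h : R -> R) (X : Omega -> 'rV[R]_d) (V : R) :
  measurable_fun `[a, b] h -> random_vector X ->
  (\int[mu]_(x in `[a, b]) (h x ^+ 2)%:E = V%:E)%E ->
  wiener_graph h X -> gauss_indep P (F b) V X.
Proof.
move=> mh rX hV [st [st_ab st_h st_X]].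
have /choice[v_ Hv] : forall n, exists v : R, [/\ 0 <= v,
   (\int[mu]_(x in `[a, b]) (step_fun (st n) x ^+ 2)%:E)%E = v%:E &
   gauss_indep P (F b) v (step_int W (st n))].
  by move=> n; exact: step_int_gauss.
have [hF1 hF2] := hF.
have [sFb Fbm] := hF1 b (introT andP (conj ab (lexx b))).
apply: (gauss_indep_cvg (v_ := v_) (X_ := fun n => step_int W (st n))) => //.
- exact: sigma_algebraT.
- by move=> n; have [] := Hv n.
- by rewrite -lee_fin -hV; exact: integral_sqr_ge0.
- apply: (@cvg_L2_norm _ _ _ mu _ (measurable_itv `[a, b]) h
    (fun n => step_fun (st n)) v_ V mh _ hV _ st_h) => //.
  + by move=> n; exact: measurable_step_fun.
  + by move=> n; have [] := Hv n.
- by move=> n; have [] := Hv n.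
move=> i delta delta0.
have d2 : 0 < delta ^+ 2 by rewrite exprn_gt0.
have mXi : measurable_fun setT (fun w => X w ord0 i).
  by move: i {st_X}; apply/random_vectorP.
pose q n := (\int[P]_w ((X w ord0 i - step_int W (st n) w ord0 i) ^+ 2)%:E)%E.
(* Chebyshev's inequality turns mean-square convergence into convergence in probability. *)
apply: (squeeze_cvge (f := fun=> 0%E) (h := fun n => ((delta ^- 2)%:E * q n)%E)).
- apply: nearW => n; rewrite measure_ge0/=.
  have mS := measurable_step_int i (st_ab n).
  have mA : measurable [set w | delta <= `|step_int W (st n) w ord0 i - X w ord0 i|].
    by have [_ _ [rS _]] := Hv n; exact: measurable_dist_ge.
  rewrite -lee_pdivrMl ?invr_gt0// invrK.
  rewrite -[X in P X]setIT -integral_indic// -ge0_integralZl//; last 2 first.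
  + by apply/measurable_EFinP.
  + by rewrite lee_fin ltW.
  apply: ge0_le_integral => //.
  + by move=> w _; rewrite -EFinM lee_fin mulr_ge0// ltW.
  + by apply: emeasurable_funM => //; apply/measurable_EFinP.
  + by apply: measurable_sqr; exact: measurable_funB.
  move=> w _; rewrite -EFinM lee_fin indicE.
  have [/set_mem/= h'|_] := boolP (w \in _); last by rewrite mulr0 sqr_ge0.
  by rewrite mulr1 -[leRHS]sqrrN opprB -[leRHS]real_normK ?num_real// lerXn2r
    ?nnegrE// ltW.
- exact: cvg_cst.
by rewrite -[X in _ --> X](mule0 (delta ^- 2)%:E); apply: cvgeZl => //; exact: st_X.
Qed.

(** The same steps work on the larger interval, since they vanish to the left of [s]. Integrals with
    different lower bounds thus become comparable. *)
Lemma reverse_ito_wiener_graph (f : R -> R) s (J : Omega -> 'rV[R]_d) :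
  a <= s -> is_reverse_ito_integral P W f s b J ->
  wiener_graph (fun x => f x * \1_(`[s, b]%classic : set R) x) J.
Proof.
move=> as_ [rJ [st [st_sb st_f st_J]]]; exists st; split.
- by move=> n q /st_sb[sq [qq qb]]; split => //; exact: le_trans sq.
- move: st_f; rewrite [X in X @ _ --> _ -> _](_ : _ = fun n =>
    (\int[mu]_(x in `[a, b]) ((f x * \1_(`[s, b]%classic :
      set R) x - step_fun (st n) x) ^+ 2)%:E)%E)//.
  apply/funext => n.
  have -> : `[s, b]%classic = `[a, b] `&` `[s, b] :> set R.
    by rewrite setIidr//; apply: subset_itvr; rewrite bnd_simp.
  rewrite integral_mkcondr; apply: eq_integral => x.
  rewrite inE/= in_itv/= => /andP[ax xb].
  rewrite patchE indicE; case: ifPn => xs; first by rewrite inE in xs;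
    rewrite mem_set ?mulr1//; split => //=; rewrite in_itv/= ax.
  rewrite memNset; last by move=> [_] /mem_set; apply/negP.
  rewrite mulr0 sub0r sqrrN /step_fun big_seq big1 ?expr0n// => q /st_sb[sq [qq qb]].
  rewrite indicE memNset ?mulr0//= in_itv/= => /andP[qx _].
  by move/negP : xs; apply; rewrite inE/= in_itv/= xb (le_trans sq).
- move=> i; have := st_J i.
  rewrite [X in X @ _ --> _ -> _](_ : _ = fun n =>
    (\int[P]_w ((J w ord0 i - step_int W (st n) w ord0 i) ^+ 2)%:E)%E)//.
  by apply/funext => n; rewrite unlock.
Qed.
End ito_class.

(** * The linear equation along a path *)

Section partition_limits.
Context {R : realType}.
Local Notation mu := (@lebesgue_measure R).
Variables (a b : R).
Hypothesis ab : a < b.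

Lemma uniform_continuity_itv (f : R -> R) (e : R) :
  {within `[a, b], continuous f} -> 0 < e ->
  exists2 dl : R, 0 < dl & forall x z, a <= x <= b -> a <= z <= b ->
    `|x - z| < dl -> `|f x - f z| < e.
Proof.
move=> /subspace_continuousP cf e0.
have /compact_near_coveringP cpt := @segment_compact R a b.
pose Q (dl x : R) := a <= x <= b -> forall z, a <= z <= b -> `|x - z|
  < dl -> `|f x - f z| < e.
have : \forall dl \near 0^'+, `[a, b]%classic `<=` Q dl.
  apply: cpt => x xab.
  have e20 : 0 < e / 2 by rewrite divr_gt0.
  have /cvgrPdist_lt/(_ _ e20) := cf x xab.
  rewrite near_withinE => /nbhs_ballP[eta/= eta0 H].
  have eta2 : 0 < eta / 2 by rewrite divr_gt0.
  (* If [x'] is within [eta / 2] of [x] and [z] within [eta / 2] of [x'], both are within [eta] of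
     [x]. *)
  exists (ball x (eta / 2), [set dl : R | dl < eta / 2]).
    split; first exact: nbhsx_ballx.
    by apply: nbhs_right_lt.
  move=> [x' dl] /= [xx' dl_eta] x'ab z zab x'z.
  have h1 := H x'; have h2 := H z.
  have {}h1 : `|f x - f x'| < e / 2.
    apply: h1; last by rewrite /= in_itv.
    by apply: le_ball xx'; lra.
  have {}h2 : `|f x - f z| < e / 2.
    apply: h2; last by rewrite /= in_itv.
    rewrite /ball/= [ltRHS]splitr -(subrKA x') (le_lt_trans (ler_normD _ _))//.
    by rewrite ltrD// (lt_trans x'z).
  rewrite [ltRHS]splitr -(subrKA (f x)) (le_lt_trans (ler_normD _ _))//.
  by rewrite ltrD// distrC.
move=> H.
have [dl [dl0 Hdl]] : exists dl : R, 0 < dl /\ `[a, b]%classic `<=` Q dl.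
  near (0 : R)^'+ => dl; exists dl; split; first by near: dl; exact: nbhs_right_gt.
  by near: dl.
exists dl => // x z xab zab; apply: Hdl => //=; by rewrite in_itv.
Unshelve. all: by end_near. Qed.

Definition part n k : R := a + (b - a) * (k%:R / n.+1%:R).

Lemma part0 n : part n 0 = a. Proof. by rewrite /part mul0r mulr0 addr0. Qed.
Lemma partS n : part n n.+1 = b.
Proof. by rewrite /part divff ?pnatr_eq0// mulr1 subrKC. Qed.

Lemma part_step n k : part n k.+1 = part n k + (b - a) / n.+1%:R.
Proof.
rewrite /part; have -> : k.+1%:R = k%:R + 1 :> R by rewrite natr1.
by rewrite (mulrDl k%:R) mulrDr mul1r addrA.
Qed.

Lemma part_lt n k : part n k < part n k.+1.
Proof. by rewrite part_step ltrDl divr_gt0 ?subr_gt0// ltr0n. Qed.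

Lemma part_in n k : (k <= n.+1)%N -> a <= part n k <= b.
Proof.
move=> kn; have p_lt j : (j < n.+1)%N -> part n j < part n j.+1.
  by move=> _; exact: part_lt.
have := ler_homo_nat p_lt (leq0n k) kn; have := ler_homo_nat p_lt kn (leqnn _).
by rewrite part0 partS => -> ->.
Qed.

Lemma part_mesh (dl : R) : 0 < dl ->
  \forall n \near \oo, forall k, part n k.+1 - part n k < dl.
Proof.
move=> dl0; near=> n => k; rewrite part_step addrC addKr.
rewrite ltr_pdivrMr ?ltr0n// mulrC -ltr_pdivrMr//.
rewrite -natr1 ltr_wpDr//; near: n; exact: nbhs_infty_gtr.
Unshelve. all: by end_near. Qed.

Lemma part_osc (f : R -> R) (e : R) : {within `[a, b], continuous f} -> 0 < e ->
  \forall n \near \oo, forall k x, (k < n.+1)%N ->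
    part n k <= x <= part n k.+1 -> `|f x - f (part n k.+1)| <= e.
Proof.
move=> cf e0; have [dl dl0 H] := uniform_continuity_itv cf e0.
near=> n => k x kn /andP[px xp]; apply/ltW/H.
- have /andP[h1 _] := part_in (ltnW kn); have /andP[_ h2] := part_in kn.
  by rewrite (le_trans h1)// (le_trans xp).
- exact: part_in.
rewrite distrC ger0_norm ?subr_ge0// (@le_lt_trans _ _ (part n k.+1 - part n k))//.
  by rewrite lerD2l lerN2.
by move: k {kn px xp}; near: n; exact: part_mesh.
Unshelve. all: by end_near. Qed.

(** From [1 - x <= exp (- x) <= 1 / (1 + x) <= 1 - x + x ^+ 2]. It exchanges increments of an
    exponential for increments of its exponent. *)
Lemma expRN_second_order (x : R) : 0 <= x -> 0 <= x - (1 - expR (- x)) <= x ^+ 2.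
Proof.
move=> x0; apply/andP; split; first by have := expR_ge1Dx (- x); lra.
have ex : expR (- x) <= (1 + x)^-1.
  by rewrite expRN lef_pV2 ?posrE ?expR_gt0 ?expR_ge1Dx// ltr_wpDr.
suff : (1 + x)^-1 <= 1 - x + x ^+ 2 by lra.
rewrite -div1r ler_pdivrMr ?ltr_wpDr//.
have : 0 <= x ^+ 3 by rewrite exprn_ge0.
nra.
Qed.

Lemma sum_part (f : R -> R) n :
  \sum_(k < n.+1) (f (part n k) - f (part n k.+1)) = f a - f b.
Proof.
rewrite -(big_mkord predT (fun k => f (part n k) - f (part n k.+1))).
rewrite (eq_bigr (fun k => - (f (part n k.+1) - f (part n k)))); last first.
  by move=> k _; rewrite opprB.
by rewrite sumrN telescope_sumr// part0 partS opprB.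
Qed.

(** Pathwise variation of constants: the left-hand side is a Riemann-Stieltjes
    sum of [exp G] against the driving path [y + int g y]. *)
Lemma variation_of_constants (y g G : R -> R) :
  {within `[a, b], continuous y} -> {within `[a, b], continuous G} ->
  (forall s, a <= s <= b -> 0 <= g s) ->
  mu.-integrable `[a, b] (EFin \o g) ->
  mu.-integrable `[a, b] (EFin \o (fun s => g s * y s)) ->
  (forall s r, a <= s -> s <= r -> r <= b ->
     \int[mu]_(x in `[s, r]) g x = G s - G r) ->
  \sum_(k < n.+1) expR (G (part n k)) * ((y (part n k) - y (part n k.+1)) +
      \int[mu]_(x in `[part n k, part n k.+1]) (g x * y x)) @[n --> \oo] -->
  expR (G a) * y a - expR (G b) * y b.
Proof.
move=> cy cG g0 ig igy gG.
have G_le s r : a <= s -> s <= r -> r <= b -> G r <= G s.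
  move=> as_ sr rb; rewrite -subr_ge0 -gG//; apply: Rintegral_ge0 => x /=.
  rewrite in_itv/= => /andP[sx xr]; apply: g0.
  by rewrite (le_trans as_)// (le_trans xr).
have [M M0 yM] : exists2 M : R, 0 <= M & forall s, a <= s <= b -> `|y s| <= M.
  have [c1 _ h1] := EVT_max (ltW ab) cy; have [c2 _ h2] := EVT_min (ltW ab) cy.
  exists (`|y c1| + `|y c2|) => [|s sab]; first exact: addr_ge0.
  have {}h1 := h1 s; have {}h2 := h2 s; rewrite !in_itv/= in h1 h2.
  rewrite ler_norml; apply/andP; split.
    rewrite lerNl (@le_trans _ _ `|y c2|) ?lerDr// -normrN.
    by rewrite (le_trans _ (ler_norm _))// lerN2 h2.
  by rewrite (le_trans (h1 sab))// (le_trans (ler_norm _))// lerDl.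
apply/cvgrPdist_le => e e0.
(* The errors of all cells will add up to [(K - 1) * (e / K)]; the summand 1 keeps [K] positive. *)
pose K := expR (G a) * (1 + M) * (G a - G b) + 1.
have Gab : 0 <= G a - G b by rewrite subr_ge0 G_le// ltW.
have K0 : 0 < K by rewrite ltr_wpDl// mulr_ge0// mulr_ge0 ?expR_ge0 ?addr_ge0.
have eK : 0 < e / K by rewrite divr_gt0.
near=> n.
have osc_y k x : (k < n.+1)%N -> part n k <= x <= part n k.+1 ->
  `|y x - y (part n k.+1)| <= e / K.
  by move: k x; near: n; exact: part_osc.
have osc_G k : (k < n.+1)%N -> `|G (part n k) - G (part n k.+1)| <= e / K.
  move=> kn; suff : forall x, part n k <= x <= part n k.+1 -> `|G x - G (part n
    k.+1)| <= e / K.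
    by apply; rewrite lexx ltW// part_lt.
  move=> x; move: k x kn; near: n; exact: part_osc.
rewrite -[X in `|X - _|](sum_part (fun s => expR (G s) * y s) n) -sumrB.
apply: (le_trans (ler_norm_sum _ _ _)).
apply: (@le_trans _ _ (\sum_(k < n.+1) expR (G a) * (1 + M) * (e / K) *
   (G (part n k) - G (part n k.+1)))); last first.
  rewrite -mulr_sumr (sum_part G) mulrAC.
  have -> : expR (G a) * (1 + M) * (G a - G b) = K - 1 by rewrite /K addrK.
  have K1 : (K - 1) / K <= 1 by rewrite ler_pdivrMr// mul1r lerBlDr lerDl.
  rewrite mulrCA.
  by rewrite ler_piMr// ltW.
apply: ler_sum => k _.
set s := part n k; set r := part n k.+1; set D := G s - G r.
have /andP[as_ _] := part_in (ltnW (ltn_ord k)).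
have /andP[_ rb] := part_in (ltn_ord k).
have sr : s <= r by apply/ltW/part_lt.
have D0 : 0 <= D by rewrite subr_ge0 G_le.
have De : D <= e / K by rewrite (le_trans (ler_norm _))// osc_G.
have sub : `[s, r] `<=` `[a, b].
  by apply: subset_itv; rewrite bnd_simp.
have mI : @measurable _ (measurableTypeR R) `[s, r] by exact: measurable_itv.
have igs : mu.-integrable `[s, r] (EFin \o g) by exact: integrableS ig.
have igys : mu.-integrable `[s, r] (EFin \o (fun s => g s * y s)) by exact:
  integrableS igy.
have int_dev : `|\int[mu]_(x in `[s, r]) (g x * y x) - D * y r| <= e / K * D.
  rewrite /D -gG// -RintegralZr// -RintegralZl//.
  have igyr : mu.-integrable `[s, r] (EFin \o (fun x => g x * y r)).
    have := integrableZr mI (y r) igs.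
    by apply: eq_integrable => // x _; rewrite /= -EFinM.
  rewrite -RintegralB//.
  apply: (le_trans (le_normr_Rintegral _ _)) => //.
    exact: (integrableB mI igys igyr).
  apply: le_Rintegral => //.
  - by apply: integrable_norm; exact: (integrableB mI igys igyr).
  - have := integrableZl mI (e / K) igs.
    by apply: eq_integrable => // x _; rewrite /= -EFinM.
  move=> x; rewrite /= in_itv/= => xsr; have /andP[sx xr] := xsr.
  have gx : 0 <= g x by apply: g0; rewrite (le_trans as_)// (le_trans xr).
  by rewrite -mulrBr normrM ger0_norm// mulrC ler_wpM2r// osc_y.
have [/andP[q0 q1]] : 0 <= D - (1 - expR (- D)) <= D ^+ 2 by exact: expRN_second_order.
have Gs : expR (G r) = expR (G s) * expR (- D).
  by rewrite -expRD; congr expR; rewrite /D; ring.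
(* The error on a cell has two sources: replacing [y] by its right-end value, at most [e / K * D],
   and linearizing the exponential, at most [D ^+ 2 * M], hence at most [e / K * D * M]. *)
rewrite [X in `|X|](_ : _ = - (expR (G s) *
    ((\int[mu]_(x in `[s, r]) (g x * y x) - D * y r) +
     (D - (1 - expR (- D))) * y r))); last by rewrite Gs; ring.
rewrite normrN normrM ger0_norm ?expR_ge0//.
have yr : `|y r| <= M by apply: yM; rewrite rb andbT (le_trans as_).
have eGs : expR (G s) <= expR (G a) by rewrite ler_expR G_le// (le_trans sr).
rewrite -[leRHS]mulrA -[leRHS]mulrA; apply: ler_pM => //.
rewrite [leRHS]mulrDl mul1r; apply: le_trans (ler_normD _ _) _; apply: lerD => //.
rewrite normrM ger0_norm// mulrC; apply: ler_pM => //.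
by rewrite (le_trans q1)// expr2 ler_wpM2r.
Unshelve. all: by end_near. Qed.

(** With [I] the integral of [eps ^+ 2], these sums approximate the integral of [t ^+ 2 * expR A]
    against [- dA]. Each term is pinched between an increment of [t ^+ 2 * expR A] and [1 + 8 * th]
    times it, and the increments telescope. *)
Lemma exp_riemann_limit (A : R -> R) (I : R -> R -> R) (t : R) : 0 < a ->
  {within `[a, b], continuous A} ->
  (forall s r, a <= s -> s <= r -> r <= b -> A r <= A s) ->
  (forall s r, a <= s -> s <= r -> r <= b ->
     s ^+ 2 * (A s - A r) <= I s r <= r ^+ 2 * (A s - A r)) ->
  \sum_(k < n.+1) (t / part n k * expR (A (part n k) / 2)) ^+ 2 *
     I (part n k) (part n k.+1) @[n --> \oo] -->
  t ^+ 2 * (expR (A a) - expR (A b)).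
Proof.
move=> a0 cA A_le IA.
have E0 : 0 <= expR (A a) - expR (A b) by rewrite subr_ge0 ler_expR A_le// ltW.
set L := t ^+ 2 * _; have L0 : 0 <= L by rewrite mulr_ge0// sqr_ge0.
apply/cvgrPdist_le => e e0.
pose th := Num.min (2^-1) (e / (8 * (L + 1))).
have th0 : 0 < th by rewrite lt_min invr_gt0 ltr0n/= !(divr_gt0, mulr_gt0)// ltr_wpDl.
have th_half : th <= 2^-1 by rewrite ge_min lexx.
have thL : 8 * th * L <= e.
  have : th <= e / (8 * (L + 1)) by rewrite ge_min lexx orbT.
  rewrite ler_pdivlMr; first by nra.
  by rewrite mulr_gt0// ltr_wpDl.
clearbody th.
near=> n.
have osc_A k : (k < n.+1)%N -> A (part n k) - A (part n k.+1) <= th.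
  move=> kn; apply: le_trans (ler_norm _) _.
  suff : forall x, part n k <= x <= part n k.+1 -> `|A x - A (part n k.+1)| <= th.
    by apply; rewrite lexx ltW// part_lt.
  move=> x; move: k x kn; near: n; exact: part_osc.
(* As all points are at least [a], consecutive ones have ratio at most [1 + th]. *)
have mesh k : part n k.+1 - part n k < th * a.
  by move: k; near: n; apply: part_mesh; rewrite mulr_gt0.
have key k : (k < n.+1)%N ->
  t ^+ 2 * (expR (A (part n k)) - expR (A (part n k.+1))) <=
  (t / part n k * expR (A (part n k) / 2)) ^+ 2 * I (part n k) (part n k.+1) <=
  (1 + 8 * th) * (t ^+ 2 * (expR (A (part n k)) - expR (A (part n k.+1)))).
  move=> kn; have pk := part_lt n k; have oA := osc_A k kn; have mk := mesh k.
  have /andP[as_ _] := part_in (ltnW kn).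
  have /andP[_ rb] := part_in kn.
  move: pk oA mk as_ rb; set s := part n k; set r := part n k.+1.
  move=> sr oA mk as_ rb; have /andP[I1 I2] := IA s r as_ (ltW sr) rb.
  have s0 : 0 < s by exact: lt_le_trans as_.
  have D0 : 0 <= A s - A r by rewrite subr_ge0 A_le// ltW.
  have /andP[q0 q1] := expRN_second_order D0.
  have Ar : expR (A r) = expR (A s) * expR (- (A s - A r)).
    by rewrite -expRD; congr expR; ring.
  have eA := expR_gt0 (A s).
  have sqE : (t / s * expR (A s / 2)) ^+ 2 = t ^+ 2 * (expR (A s) / s ^+ 2).
    rewrite !exprMn exprVn -mulrA; congr (_ * _).
    by rewrite mulrC; congr (_ * _); rewrite -expRM_natl; congr expR; field.
  have t2 := sqr_ge0 t.
  have s2 : 0 < s ^+ 2 by rewrite exprn_gt0.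
  have J1 : A s - A r <= I s r / s ^+ 2 by rewrite ler_pdivlMr// mulrC.
  have J2 : I s r / s ^+ 2 <= (1 + th) ^+ 2 * (A s - A r).
    rewrite ler_pdivrMr// (le_trans I2)// [leRHS]mulrAC ler_wpM2r// -exprMn.
    have r0 : 0 < r by exact: lt_trans sr.
    have rs : r <= (1 + th) * s by nra.
    have rs0 : 0 <= (1 + th) * s by exact: le_trans (ltW r0) rs.
    by apply: lerXn2r => //; rewrite nnegrE ltW.
  have bnd : expR (A s) - expR (A r) <= expR (A s) * (I s r / s ^+ 2) <=
      (1 + 8 * th) * (expR (A s) - expR (A r)).
    rewrite Ar; move: (A s - A r) q0 q1 (I s r / s ^+ 2) J1 J2 D0 oA => {Ar I1 I2}.
    move=> D; move: (expR (- D)) => q q0 q1 J J1 J2 D0 oA.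
    have DD : D ^+ 2 <= th * D by rewrite expr2 ler_wpM2r.
    have qD : (1 - th) * D <= 1 - q by lra.
    (* The constant 8 comes from [(1 + th) ^+ 2 <= (1 + 8 * th) * (1 - th)], valid for
       [th <= 1 / 2]. *)
    have qJ : J <= (1 + 8 * th) * (1 - q).
      apply: (le_trans J2); apply: (@le_trans _ _ ((1 + 8 * th) * ((1 - th) * D))).
        rewrite mulrA ler_wpM2r//; nra.
      by rewrite ler_wpM2l// addr_ge0// mulr_ge0// ltW.
    have Jq : 1 - q <= J by lra.
    rewrite (_ : _ - _ = expR (A s) * (1 - q)); last by ring.
    by rewrite mulrCA !ler_wpM2l// ltW.
  have /andP[b1 b2] := bnd.
  have -> : (t / s * expR (A s / 2)) ^+ 2 * I s r = t ^+ 2 * (expR (A s) * (I s r / s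
    ^+ 2)).
    by rewrite sqE; ring.
  apply/andP; split; first by rewrite ler_wpM2l.
  by rewrite [leRHS]mulrCA ler_wpM2l.
rewrite distrC ger0_norm; last first.
  rewrite subr_ge0 /L -(sum_part (fun s => expR (A s)) n) mulr_sumr.
  by apply: ler_sum => k _; have /andP[] := key k (ltn_ord k).
rewrite lerBlDl (@le_trans _ _ ((1 + 8 * th) * L))//;
  last by rewrite mulrDl mul1r lerD2l.
rewrite /L -(sum_part (fun s => expR (A s)) n) !mulr_sumr.
by apply: ler_sum => k _; have /andP[] := key k (ltn_ord k).
Unshelve. all: by end_near. Qed.
End partition_limits.

(** * The logarithmic singularity at 0 *)

Section inverse_integral.
Context {R : realType}.
Local Notation mu := (@lebesgue_measure R).

Lemma within_continuous_inv (s r : R) : 0 < s ->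
  {within `[s, r], continuous (fun x : R => x^-1)}.
Proof.
move=> s0; apply: continuous_in_subspaceT => x.
rewrite inE/= in_itv/= => /andP[sx _]; apply: inv_continuous.
by rewrite gt_eqF// (lt_le_trans s0).
Qed.

Lemma integrable_inv (s r : R) : 0 < s ->
  mu.-integrable `[s, r] (EFin \o (fun x : R => x^-1)).
Proof.
move=> s0; apply: continuous_compact_integrable; first exact: segment_compact.
exact: within_continuous_inv.
Qed.

Lemma Rintegral_inv (s r : R) : 0 < s -> s <= r ->
  \int[mu]_(x in `[s, r]) x^-1 = ln r - ln s.
Proof.
move=> s0; rewrite le_eqVlt => /orP[/eqP->|sr].
  by rewrite subrr set_itv1 Rintegral_set1.
apply: EFin_inj; rewrite /Rintegral fineK; last first.
  by apply: integrable_fin_num => //; exact: integrable_inv.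
rewrite (@continuous_FTC2 _ _ (@ln R))//.
- exact: within_continuous_inv.
- split.
  + move=> x; rewrite in_itv/= => /andP[sx _].
    by have [] := is_derive1_ln (lt_trans s0 sx).
  + by apply: cvg_at_right_filter; exact: continuous_ln.
  + by apply: cvg_at_left_filter; apply: continuous_ln; exact: lt_trans sr.
- move=> x; rewrite in_itv/= => /andP[sx _].
  by rewrite derive1E; have [_ ->] := is_derive1_ln (lt_trans s0 sx).
Qed.

Lemma not_integrable_inv (f : R -> R) (c dl : R) : 0 < c -> 0 < dl ->
  mu.-integrable `[0, dl] (EFin \o f) ->
  (forall r, 0 < r <= dl -> c / r <= `|f r|) -> False.
Proof.
move=> c0 dl0 intf fc.
have mI (x y : R) : @measurable _ (measurableTypeR R) `[x, y] by exact: measurable_itv.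
have intnf := integrable_norm intf.
pose K := \int[mu]_(x in `[0, dl]) `|f x|.
have K0 : 0 <= K by apply: Rintegral_ge0 => x _.
(* Chosen so that the integral of [c / x] over [[eta, dl]] is [K + c], more than the integral [K] of
   [|f|] allows. *)
pose eta := dl * expR (- (K / c + 1)).
have eta0 : 0 < eta by rewrite mulr_gt0// expR_gt0.
have Kc : 0 <= K / c + 1 by rewrite addr_ge0// divr_ge0// ltW.
have eta_dl : eta <= dl.
  by rewrite /eta ler_piMr ?(ltW dl0)// -[leRHS]expR0 ler_expR oppr_le0.
have sub : `[eta, dl] `<=` `[0, dl].
  by apply: subset_itv; rewrite bnd_simp// ltW.
have : \int[mu]_(x in `[eta, dl]) (c * x^-1) <= K.
  apply: (@le_trans _ _ (\int[mu]_(x in `[eta, dl]) `|f x|)).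
    apply: le_Rintegral => //.
    - have := integrableZl (mI _ _) c (integrable_inv dl eta0).
      by apply: eq_integrable => // x _; rewrite /= -EFinM.
    - by apply: integrableS intnf.
    - move=> x; rewrite /= in_itv/= => /andP[ex xd].
      by apply: fc; rewrite xd (lt_le_trans eta0).
  rewrite /K /Rintegral fine_le//.
  - by apply: integrable_fin_num => //; apply: integrableS intnf.
  - exact: integrable_fin_num.
  apply: ge0_subset_integral => //.
  exact: measurable_int intnf.
rewrite RintegralZl//; last exact: integrable_inv.
rewrite Rintegral_inv// /eta lnM ?posrE ?expR_gt0// expRK.
have cK : c * (K / c) = K by rewrite mulrCA divff ?mulr1// gt_eqF.
suff : c * (ln dl - (ln dl - (K / c + 1))) = K + c by lra.
by rewrite opprB addrCA subrr addr0 mulrDr cK mulr1.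
Qed.
End inverse_integral.

(** * Convergence in probability and independence *)

Section probability_tools.
Context {dO : measure_display} {Omega : measurableType dO} {R : realType}.
Variable P : probability Omega R.

(** Dominated convergence for the indicators of the deviation events. *)
Lemma ae_cvg_in_probability (f_ : nat -> Omega -> R) (f : Omega -> R) (delta : R) :
  0 < delta -> (forall n, measurable_fun setT (f_ n)) -> measurable_fun setT f ->
  {ae P, forall w, f_ n w @[n --> \oo] --> f w} ->
  P [set w | delta <= `|f_ n w - f w|] @[n --> \oo] --> 0%E.
Proof.
move=> delta0 mf_ mf f_f.
pose A n := [set w | delta <= `|f_ n w - f w|].
have mA n : measurable (A n).
  rewrite (_ : A n = (fun w => `|f_ n w - f w|) @^-1` `[delta, +oo[).
    rewrite -[X in measurable X]setTI; apply: measurableT_comp => //.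
    exact: measurable_funB.
  by apply/seteqP; split => w; rewrite /A/= in_itv/= andbT.
have := @dominated_convergence _ _ _ P setT measurableT
  (fun n w => (\1_(A n) w)%:E) (cst 0%E) (cst 1%E).
case=> //.
- by move=> n; apply/measurable_EFinP.
- apply: filterS f_f => w f_w _.
  apply: cvg_near_cst; near=> n; congr EFin; rewrite indicE memNset// /A/=.
  apply/negP; rewrite -ltNge distrC; near: n.
  by move/cvgrPdist_lt : f_w; apply.
- exact: finite_measure_integrable_cst.
- apply: aeW => w n _ /=; rewrite lee_fin indicE.
  by case: (_ \in _); rewrite ?normr1// normr0.
move=> _ _; rewrite integral0.
rewrite [X in X @ _ --> _ -> _](_ : _ = (fun n => P (A n)))//.
by apply/funext => n /=; rewrite integral_indic// setIT.
Unshelve. all: by end_near. Qed.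

Lemma gauss_indep_sigma {d : nat} (F G : set_system Omega) v (X : Omega -> 'rV[R]_d) :
  sigma_algebra setT F -> F `<=` measurable -> G `<=` F ->
  gauss_indep P F v X -> indep_sigma P (sigma_of X) G.
Proof.
move=> sF Fm GF [rX hX] A C XA GC.
pose Box := [set D | exists2 B : 'I_d -> set R, (forall i, measurable (B i)) &
  D = [set w | forall i, B i (X w ord0 i)]].
have mC := Fm _ (GF _ GC).
have FT := sigma_algebraT sF.
have Boxm : Box `<=` measurable.
  by move=> _ [B mB ->]; apply: rX; exact: sigma_of_box.
pose H := [set D | Box D /\ D `<=` setT].
have sA : <<s H >> A.
  apply: (sigma_of_sub (F := <<s H >>)) XA => [|i D mD].
    exact: smallest_sigma_algebra.
  apply: sub_sigma_algebra; split => //.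
  exists (fun j => if j == i then D else setT); first by move=> j; case: ifP.
  apply/seteqP; split => w /=; last by move=> /(_ i); rewrite eqxx.
  by move=> Dw j; case: eqVneq => // ->.
have c_ge0 : 0 <= fine (P C) by rewrite fine_ge0.
rewrite muleC -[P C]fineK ?fin_num_measure//.
(* For fixed [C] both sides are measures in [A]; they agree on boxes, a pi-system generating
   [sigma_of X]. *)
rewrite -[LHS]/(mrestr P mC A) -[RHS]/(mscale (NngNum c_ge0) P A).
apply: (g_sigma_algebra_measure_unique_trace Box setT) => //.
- by move=> D [/Boxm].
- move=> _ _ [[B1 mB1 ->] _] [[B2 mB2 ->] _]; split => //.
  exists (fun i => B1 i `&` B2 i); first by move=> i; exact: measurableI.
  by apply/seteqP; split => w /= => [[h1 h2] i|h]; [split|split => i; have [] := h i].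
- rewrite -[RHS]/((fine (P C))%:E * P setT)%E -[LHS]/(P (setT `&` C)) setTI.
  by rewrite probability_setT mule1 fineK// fin_num_measure.
- move=> _ [[B mB ->] _]; rewrite -[RHS]/((fine (P C))%:E * P _)%E.
  rewrite -[LHS]/(P ([set w | forall i, B i (X w ord0 i)] `&` C)) setIC.
  rewrite hX//; last exact: GF.
  rewrite fineK ?fin_num_measure//; congr (_ * _)%E.
  by have := hX _ FT B mB; rewrite setTI probability_setT mul1e => ->.
- rewrite -[X in (X < _)%E]/(P (setT `&` C)) setTI.
  by rewrite (le_lt_trans (probability_le1 _ mC))// ltry.
Qed.

Lemma gauss_indep_isotropic {d : nat} (F : set_system Omega) (X : Omega -> 'rV[R]_d) :
  F setT -> gauss_indep P F 1 X -> isotropic_gaussian P 1 X.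
Proof.
move=> FT [rX hX]; split => // B mB.
have := hX _ FT B mB; rewrite setTI probability_setT mul1e => ->.
by apply: eq_bigr => i _; exact: centered_normal1.
Qed.
End probability_tools.

(** * Weighted sums of Ito integrals over the cells of a partition *)

Section ito_partition.
Context {dO : measure_display} {Omega : measurableType dO} {R : realType}.
Variable P : probability Omega R.
Context {d : nat}.
Variables (a b : R) (F : R -> set_system Omega) (W : R -> Omega -> 'rV[R]_d).
Hypothesis ab : a <= b.
Hypotheses (hF : reverse_filtration a b F) (hW : reverse_brownian P a b F W).
Local Notation mu := (@lebesgue_measure R).

(** The whole sum is one Wiener integral, of [f] times a function constant on cells. Its variance
    then follows from the isometry, without discussing independence between the differences of the
    [J k]. *)
Lemma ito_partition_gauss (f : R -> R) (p : nat -> R) (N : nat)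
    (J : nat -> Omega -> 'rV[R]_d) (c I : nat -> R) :
  measurable_fun `[a, b] f ->
  (forall k, (k < N)%N -> p k < p k.+1) ->
  (forall k, (k <= N)%N -> a <= p k <= b) ->
  (forall k, (k <= N)%N -> is_reverse_ito_integral P W f (p k) b (J k)) ->
  (forall k, (k < N)%N ->
    (\int[mu]_(x in `[p k, p k.+1]) (f x ^+ 2)%:E)%E = (I k)%:E) ->
  gauss_indep P (F b) (\sum_(k < N) c k ^+ 2 * I k)
    (fun w => \sum_(k < N) c k *: (J k w - J k.+1 w)).
Proof.
move=> mf p_incr p_ab hJ hI.
have mI (x y : R) : @measurable _ (measurableTypeR R) `[x, y] by exact: measurable_itv.
pose cell k := `[p k, p k.+1[%classic : set R.
pose h m x := \sum_(k < m) c k * \1_(cell k) x * f x.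
pose X m := fun w => \sum_(k < m) c k *: (J k w - J k.+1 w).
have mh m : measurable_fun `[a, b] (h m).
  elim: m => [|m IH].
    rewrite (_ : h 0%N = fun=> 0); first exact: measurable_cst.
    by apply/funext => x; rewrite /h big_ord0.
  rewrite (_ : h m.+1 = fun x => h m x + c m * \1_(cell m) x * f x); last first.
    by apply/funext => x; rewrite /h big_ord_recr.
  apply: measurable_funD => //; apply: measurable_funM => //.
  by apply: measurable_funM => //; apply: measurable_funTS; apply: measurable_indic;
    exact: measurable_itv.
have mfs s : measurable_fun `[a, b] (fun x => f x * \1_(`[s, b]%classic : set R) x).
  by apply: measurable_funM => //; apply: measurable_funTS; apply: measurable_indic;
    exact: measurable_itv.
have rdiff k : (k < N)%N -> random_vector (fun w => 1 *: J k w + (-1) *: J k.+1 w).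
  move=> kN; have [/random_vectorP r1 _] := hJ k (ltnW kN).
  have [/random_vectorP r2 _] := hJ k.+1 kN.
  apply/random_vectorP => i; under eq_fun do rewrite !mxE.
  by apply: measurable_funD; exact: measurable_funM.
have main m : (m <= N)%N -> random_vector (X m) /\ wiener_graph P a b W (h m) (X m).
  elim: m => [|m IH] mN.
    have -> : X 0%N = fun=> 0 by apply/funext => w; rewrite /X big_ord0.
    have -> : h 0%N = fun=> 0 by apply/funext => w; rewrite /h big_ord0.
    split; last exact: wiener_graph0.
    apply/random_vectorP => i; under eq_fun do rewrite mxE.
    exact: measurable_cst.
  have [rX wX] := IH (ltnW mN).
  have -> : X m.+1 = fun w => 1 *: X m w + c m *: (1 *: J m w + (-1) *: J m.+1 w).
    by apply/funext => w; rewrite /X big_ord_recr/= !scale1r scaleN1r.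
  split.
    move/random_vectorP : rX => rX; move/random_vectorP : (rdiff m mN) => rD.
    apply/random_vectorP => i.
    rewrite (_ : (fun w => _) = fun w => 1 * X m w ord0 i +
      c m * (1 *: J m w + (-1) *: J m.+1 w) ord0 i); last first.
      by apply/funext => w; rewrite !mxE.
    by apply: measurable_funD; exact: measurable_funM.
  have /andP[ap0 _] := p_ab m (ltnW mN); have /andP[ap1 pb1] := p_ab m.+1 mN.
  have w1 := reverse_ito_wiener_graph ap0 (hJ m (ltnW mN)).
  have w2 := reverse_ito_wiener_graph ap1 (hJ m.+1 mN).
  have [r1 _] := hJ m (ltnW mN); have [r2 _] := hJ m.+1 mN.
  have wD := wiener_graph_lin ab hF hW 1 (-1) (mfs _) (mfs _) r1 r2 w1 w2.
  have mD : measurable_fun `[a, b] (fun x => 1 * (f x * \1_(`[p m, b]%classic :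
    set R) x) +
      (-1) * (f x * \1_(`[p m.+1, b]%classic : set R) x)).
    by apply: measurable_funD; apply: measurable_funM.
  have := wiener_graph_lin ab hF hW 1 (c m) (mh m) mD rX (rdiff m mN) wX wD.
  rewrite [X in wiener_graph _ _ _ _ X _ -> _](_ : _ = h m.+1)//.
  (* The indicators of [[p m, b]] and [[p m.+1, b]] differ by that of the half-open cell [m]. *)
  apply/funext => x; rewrite /h big_ord_recr/= mul1r; congr (_ + _).
  rewrite -mulrA; congr (_ * _); rewrite mul1r mulN1r -mulrBr mulrC; congr (_ * _).
  have pm := p_incr m mN.
  rewrite !indicE /cell; have [px|xp] := leP (p m) x; last first.
    by rewrite !memNset ?subrr//= in_itv/= => /andP[h1 h2]; lra.
  have [xb|bx] := leP x b; last first.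
    by rewrite !memNset ?subrr//= in_itv/= => /andP[h1 h2]; lra.
  rewrite [x \in `[p m, b]%classic]mem_set/= ?in_itv/= ?px//.
  have [p1x|xp1] := leP (p m.+1) x.
    rewrite [x \in `[p m.+1, b]%classic]mem_set/= ?in_itv/= ?p1x//.
    by rewrite memNset ?subrr//= in_itv/= => /andP[h1 h2]; lra.
  rewrite [x \in `[p m.+1, b]%classic]memNset/= ?in_itv/=; last first.
    by move=> /andP[h1 h2]; lra.
  by rewrite mem_set/= ?in_itv/= ?px// subr0.
have [rX wX] := main N (leqnn N).
apply: (wiener_graph_gauss ab hF hW (mh N) rX) wX.
transitivity (\int[mu]_(x in `[a, b]) \sum_(k < N)
    (c k ^+ 2)%:E * ((f x ^+ 2) * \1_(cell k) x)%:E)%E.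
  apply: eq_integral => x _; rewrite sumEFin; congr EFin.
  rewrite /h -mulr_suml exprMn sqr_sum_cells; last by move=> k /p_incr/ltW.
  by rewrite mulr_suml; apply: eq_bigr => k _; rewrite -mulrA [X in _ * X]mulrC.
have mcell k : measurable_fun `[a, b] (fun x => (f x ^+ 2 * \1_(cell k) x)%:E).
  apply/measurable_EFinP; apply: measurable_funM; first exact: measurable_funX.
  by apply: measurable_funTS; apply: measurable_indic; exact: measurable_itv.
have cell_ge0 k x : (0 <= (f x ^+ 2 * \1_(cell k) x)%:E)%E.
  by rewrite lee_fin mulr_ge0 ?sqr_ge0// indicE.
rewrite ge0_integral_sum//; first last.
- by move=> k x _; rewrite mule_ge0// lee_fin sqr_ge0.
- by move=> k; apply: emeasurable_funM => //; exact: mcell.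
rewrite -sumEFin; apply: eq_bigr => k _.
rewrite ge0_integralZl//; last first.
- by rewrite lee_fin sqr_ge0.
- exact: mcell.
rewrite [in RHS]EFinM; congr (_ * _)%E; rewrite -hI//.
have /andP[ap0 _] := p_ab k (ltnW (ltn_ord k)).
have /andP[_ pb1] := p_ab k.+1 (ltn_ord k).
rewrite -integral_itv_bndo_bndc; last first.
  apply/measurable_EFinP/measurable_funX; apply: measurable_funS mf => //.
  by apply: subset_itv; rewrite bnd_simp.
rewrite -[RHS]/(\int[mu]_(x in cell k) (f x ^+ 2)%:E)%E.
have -> : cell k = `[a, b] `&` cell k.
  rewrite setIidr//; by apply: subset_itv; rewrite bnd_simp.
rewrite integral_mkcondr; apply: eq_integral => x xab.
rewrite patchE indicE in_setI xab/=.
by case: (x \in cell k); rewrite ?mulr1 ?mulr0.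
Qed.
End ito_partition.

(** * The noise exponent and the logarithm of the integrating factor *)

Section noise_clock.
Context {R : realType}.
Local Notation mu := (@lebesgue_measure R).

Let mI (x y : R) : @measurable _ (measurableTypeR R) `[x, y].
Proof. exact: measurable_itv. Qed.

Lemma Rintegral_itv_split (f : R -> R) (s r b : R) : s <= r -> r <= b ->
  mu.-integrable `[s, b] (EFin \o f) ->
  \int[mu]_(x in `[s, b]) f x - \int[mu]_(x in `[s, r]) f x =
  \int[mu]_(x in `[r, b]) f x.
Proof.
move=> sr rb intf; rewrite Rintegral_itvB ?bnd_simp//.
apply: Rintegral_itv_obnd_cbnd; apply: integrableS intf => //.
by apply: subset_itv; rewrite bnd_simp.
Qed.

Lemma Rintegral_itv_split_right (f : R -> R) (s r b : R) : s <= r -> r <= b ->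
  mu.-integrable `[s, b] (EFin \o f) ->
  \int[mu]_(x in `[s, b]) f x - \int[mu]_(x in `[r, b]) f x =
  \int[mu]_(x in `[s, r]) f x.
Proof. by move=> sr rb intf; rewrite -(Rintegral_itv_split sr rb intf) subKr. Qed.

Lemma continuous_Rintegral_left (f : R -> R) (a b : R) : a <= b ->
  mu.-integrable `[a, b] (EFin \o f) ->
  {within `[a, b], continuous (fun s => \int[mu]_(x in `[s, b]) f x)}.
Proof.
move=> ab intf.
have := parameterized_integral_continuous ab intf => H.
pose h s := \int[mu]_(x in `[a, b]) f x - \int[mu]_(x in `[a, s]) f x.
apply: (@subspace_eq_continuous _ _ _ h).
  move=> s; rewrite inE/= in_itv/= => /andP[as_ sb].
  by rewrite /h; apply: Rintegral_itv_split.
by move=> s; apply: cvgB; [exact: cvg_cst|exact: H].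
Qed.

Variables (a b : R) (eps : R -> R).
Hypotheses (a0 : 0 < a) (ab : a < b) (b1 : b <= 1).
Hypothesis eps0 : forall s, 0 <= s <= 1 -> 0 <= eps s.
Let q s := eps s ^+ 2 / s ^+ 2.
Hypothesis intq : mu.-integrable `[a, b] (EFin \o q).
Local Notation A s := (\int[mu]_(x in `[s, b]) q x).

Let q_ge0 s : 0 <= q s. Proof. by rewrite divr_ge0 ?sqr_ge0. Qed.

Let sub_ab s r : a <= s -> r <= b -> `[s, r] `<=` `[a, b].
Proof. by move=> *; apply: subset_itv; rewrite bnd_simp. Qed.

Let intq_sub s r : a <= s -> r <= b -> mu.-integrable `[s, r] (EFin \o q).
Proof. by move=> as_ rb; apply: integrableS intq => //; exact: sub_ab. Qed.

Lemma noise_exponentB s r : a <= s -> s <= r -> r <= b ->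
  A s - A r = \int[mu]_(x in `[s, r]) q x.
Proof. by move=> as_ sr rb; apply: Rintegral_itv_split_right => //;
  exact: intq_sub. Qed.

Lemma noise_exponent_le s r : a <= s -> s <= r -> r <= b -> A r <= A s.
Proof.
move=> as_ sr rb; rewrite -subr_ge0 noise_exponentB//.
by apply: Rintegral_ge0 => x _; exact: q_ge0.
Qed.

Let eps2E s : 0 < s -> eps s ^+ 2 = s ^+ 2 * q s.
Proof. by move=> s0; rewrite /q mulrC divfK// expf_neq0// gt_eqF. Qed.

Lemma measurable_eps2 : measurable_fun `[a, b] (fun s => eps s ^+ 2).
Proof.
apply: (@eq_measurable_fun _ _ _ _ _ (fun s : R => s ^+ 2 * q s)).
  move=> s; rewrite inE/= in_itv/= => /andP[as_ _].
  by rewrite eps2E// (lt_le_trans a0).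
apply: measurable_funM; first by apply: measurable_funX.
by apply/measurable_EFinP; exact: measurable_int intq.
Qed.

(** Integrability of [eps ^+ 2 / s ^+ 2] only yields measurability of [eps ^+ 2]; since [[a, b]]
    lies in [[0, 1]], [eps] is its nonnegative square root. *)
Lemma measurable_eps : measurable_fun `[a, b] eps.
Proof.
apply: (@eq_measurable_fun _ _ _ _ _ (fun s : R => Num.sqrt (eps s ^+ 2))).
  move=> s; rewrite inE/= in_itv/= => /andP[as_ sb].
  rewrite sqrtr_sqr ger0_norm// eps0// (le_trans (ltW a0))//=.
  exact: le_trans b1.
by apply: measurableT_comp measurable_eps2; apply: continuous_measurable_fun;
  exact: sqrt_continuous.
Qed.

(** Pointwise [eps x ^+ 2 = x ^+ 2 * q x] with [s <= x <= r]. The bounds have the form that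
    [exp_riemann_limit] expects. *)
Lemma integral_eps2 s r : a <= s -> s <= r -> r <= b ->
  (\int[mu]_(x in `[s, r]) (eps x ^+ 2)%:E)%E =
    (\int[mu]_(x in `[s, r]) (eps x ^+ 2))%:E /\
  s ^+ 2 * (A s - A r) <= \int[mu]_(x in `[s, r]) (eps x ^+ 2)
    <= r ^+ 2 * (A s - A r).
Proof.
move=> as_ sr rb; have s0 := lt_le_trans a0 as_.
have intS (c : R) : mu.-integrable `[s, r] (EFin \o (fun x => c * q x)).
  have := integrableZl (mI _ _) c (intq_sub as_ rb).
  by apply: eq_integrable => // x _; rewrite /= -EFinM.
have bnd x : s <= x -> x <= r -> s ^+ 2 * q x <= eps x ^+ 2 <= r ^+ 2 * q x.
  move=> sx xr; have x0 := lt_le_trans s0 sx.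
  by rewrite eps2E// !ler_wpM2r// lerXn2r ?nnegrE// ltW// (lt_le_trans x0).
have inte : mu.-integrable `[s, r] (EFin \o (fun x => eps x ^+ 2)).
  apply: le_integrable (intS (r ^+ 2)) => //.
    apply/measurable_EFinP; apply: measurable_funS measurable_eps2 => //.
    exact: sub_ab.
  move=> x; rewrite /= in_itv/= => /andP[sx xr].
  have /andP[_ h] := bnd x sx xr.
  by rewrite lee_fin ger0_norm ?sqr_ge0// (le_trans h)// ler_norm.
split; first by rewrite /Rintegral fineK//; exact: integrable_fin_num.
rewrite noise_exponentB// -!RintegralZl//; try exact: intq_sub.
apply/andP; split; apply: le_Rintegral => // x /=; rewrite in_itv/= => /andP[sx xr];
  by have /andP[] := bnd x sx xr.
Qed.

(** The coefficient [g] of the linear equation; [clock] below is the logarithm of [Phi]. *)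
Definition clock_rate s := s^-1 + q s / 2.
Definition clock s := ln b - ln s + A s / 2.

Lemma expR_clock s : 0 < s -> expR (clock s) = b / s * expR (A s / 2).
Proof.
move=> s0; have b0 : 0 < b by exact: lt_trans ab.
by rewrite /clock expRD expRB !lnK ?posrE.
Qed.

Lemma clock_b : clock b = 0.
Proof. by rewrite /clock subrr add0r set_itv1 Rintegral_set1 mul0r. Qed.

Lemma clock_rate_ge0 s : a <= s <= b -> 0 <= clock_rate s.
Proof.
move=> /andP[as_ _]; have s0 := ltW (lt_le_trans a0 as_).
by rewrite addr_ge0 ?invr_ge0// mulr_ge0// q_ge0.
Qed.

Let intq2 s r : a <= s -> r <= b -> mu.-integrable `[s, r] (EFin \o (fun x => q x / 2)).
Proof.
move=> as_ rb; have := integrableZr (mI _ _) 2^-1 (intq_sub as_ rb).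
by apply: eq_integrable => // x _; rewrite /= -EFinM.
Qed.

Lemma integrable_clock_rate : mu.-integrable `[a, b] (EFin \o clock_rate).
Proof.
exact: (integrableD (mI _ _) (integrable_inv b a0) (intq2 (lexx a) (lexx b))).
Qed.

Lemma integral_clock_rate s r : a <= s -> s <= r -> r <= b ->
  \int[mu]_(x in `[s, r]) clock_rate x = clock s - clock r.
Proof.
move=> as_ sr rb; have s0 := lt_le_trans a0 as_.
rewrite /clock_rate RintegralD//; [|exact: integrable_inv|exact: intq2].
rewrite Rintegral_inv// RintegralZr//; last exact: intq_sub.
by rewrite -noise_exponentB// /clock; ring.
Qed.

Lemma continuous_noise_exponent : {within `[a, b], continuous (fun s => A s)}.
Proof. by apply: continuous_Rintegral_left => //; exact: ltW. Qed.

Lemma continuous_clock : {within `[a, b], continuous clock}.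
Proof.
move=> s; apply: cvgD.
  apply: cvgB; first exact: cvg_cst.
  move: s; apply: continuous_in_subspaceT => x.
  rewrite inE/= in_itv/= => /andP[ax _]; apply: continuous_ln.
  exact: lt_le_trans ax.
by apply: cvgM; [exact: continuous_noise_exponent|exact: cvg_cst].
Qed.
End noise_clock.

(** * The reverse step *)

Section frozen_step.
Context {R : realType} {dO : measure_display} {Omega : measurableType dO}.
Variables (P : probability Omega R) (d : nat) (a b : R).
Hypotheses (ab : a < b) (b1 : b <= 1).
Variable eps : R -> R.
Hypothesis heps : forall s, 0 <= s <= 1 -> 0 <= eps s.
Hypothesis hA : lebesgue_measure.-integrable `[a, b]
  (fun s : R => (eps s ^+ 2 / s ^+ 2)%:E).
Variables (F : R -> set_system Omega) (hF : reverse_filtration a b F).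
Variables (W : R -> Omega -> 'rV[R]_d) (hW : reverse_brownian P a b F W).
Variables (zhat Z : R -> Omega -> 'rV[R]_d).
Hypothesis zhatZ : sigma_of (zhat b) `<=` sigma_of (Z b).
Hypothesis hZ : reverse_sde_solution P a b F W
  (fun s w => fm_drift eps s (zhat s w) (Z s w)) eps Z.
Hypothesis hfrozen : {ae P, forall w, forall s : R, a <= s <= b ->
  zhat s w = zhat b w}.
Local Notation mu := (@lebesgue_measure R).
Local Notation A s := (noise_exponent eps s b).

Let mI (x y : R) : @measurable _ (measurableTypeR R) `[x, y].
Proof. exact: measurable_itv. Qed.

Let intc (c x y : R) : mu.-integrable `[x, y] (EFin \o (fun=> c)).
Proof.
have mu_fin : (mu `[x, y]%classic < +oo)%E.
  by rewrite lebesgue_measure_itv/=; case: ifP => _; rewrite -?EFinB ltry.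
by apply: measurable_bounded_integrable => //; exact: bounded_cst.
Qed.

(** The deviation [Y_s], formed with the value [zhat b] at the starting time, whose measurability
    comes from [zhatZ]. *)
Definition frozen_dev s w := Z s w - (1 - s) *: zhat b w.

Lemma random_vector_Z s : a <= s <= b -> random_vector (Z s).
Proof.
move=> sab; have [adZ _ _ _] := hZ; have [hF1 _] := hF.
exact: (subset_trans (adZ s sab) (hF1 s sab).2).
Qed.

Lemma random_vector_zhat : random_vector (zhat b).
Proof.
apply: (subset_trans zhatZ); apply: random_vector_Z.
by rewrite (ltW ab) lexx.
Qed.

(** Since [z - zh] is the deviation minus [s * zh], division by [s] leaves the constant [- zh],
    which is also the derivative of [(1 - s) * zh]. *)
Lemma fm_driftE s (zh z : R) : s != 0 ->
  s^-1 * (z - zh) + eps s ^+ 2 / (2 * s ^+ 2) * (z - (1 - s) * zh) =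
  clock_rate eps s * (z - (1 - s) * zh) - zh.
Proof. by move=> s0; rewrite /clock_rate; field. Qed.

Local Notation drift r w i := (fm_drift eps r (zhat r w) (Z r w) ord0 i).

(** The right-hand side is the increment of the driving path in [variation_of_constants].
    Integrability of the linear drift of [Y] comes from that of the full drift by adding back the
    constant [zhat b]. *)
Lemma frozen_dev_increment (J : R -> Omega -> 'rV[R]_d) w : 0 < a ->
  (forall s, a <= s <= b -> zhat s w = zhat b w) ->
  (forall i, mu.-integrable `[a, b] (fun r => (drift r w i)%:E)) ->
  forall s r, a <= s -> s <= r -> r <= b ->
  Z s w = Z b w - \row_i (\int[mu]_(x in `[s, b]) drift x w i) + J s w ->
  Z r w = Z b w - \row_i (\int[mu]_(x in `[r, b]) drift x w i) + J r w ->
  forall i,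
  mu.-integrable `[a, b]
    (EFin \o (fun x => clock_rate eps x * frozen_dev x w ord0 i)) /\
  J s w ord0 i - J r w ord0 i =
    (frozen_dev s w ord0 i - frozen_dev r w ord0 i) +
    \int[mu]_(x in `[s, r]) (clock_rate eps x * frozen_dev x w ord0 i).
Proof.
move=> a0 frz intd s r as_ sr rb Es Er i.
have driftE x : a <= x -> x <= b -> drift x w i =
    clock_rate eps x * frozen_dev x w ord0 i - zhat b w ord0 i.
  move=> ax xb; rewrite frz ?ax// /frozen_dev /fm_drift !mxE fm_driftE//.
  by rewrite gt_eqF// (lt_le_trans a0).
have intgy : mu.-integrable `[a, b]
  (EFin \o (fun x => clock_rate eps x * frozen_dev x w ord0 i)).
  have := integrableD (mI a b) (intd i) (intc (zhat b w ord0 i) a b).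
  apply: eq_integrable => // x; rewrite inE/= in_itv/= => /andP[ax xb].
  by rewrite driftE// -EFinD subrK.
have sub_ab x y : a <= x -> y <= b -> `[x, y] `<=` `[a, b].
  by move=> *; apply: subset_itv; rewrite bnd_simp.
split => //.
have intds x : a <= x -> mu.-integrable `[x, b] (EFin \o (fun x => drift x w i)).
  by move=> ax; apply: integrableS (intd i) => //; exact: sub_ab.
have Hs : J s w ord0 i = Z s w ord0 i - Z b w ord0 i +
   \int[mu]_(x in `[s, b]) drift x w i.
  by rewrite {1}Es !mxE; ring.
have Hr : J r w ord0 i = Z r w ord0 i - Z b w ord0 i +
   \int[mu]_(x in `[r, b]) drift x w i.
  by rewrite {1}Er !mxE; ring.
have Hd := Rintegral_itv_split_right sr rb (intds s as_).
have Hsr : \int[mu]_(x in `[s, r]) drift x w i =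
   \int[mu]_(x in `[s, r]) (clock_rate eps x * frozen_dev x w ord0 i) -
   (r - s) * zhat b w ord0 i.
  transitivity (\int[mu]_(x in `[s, r])
      (clock_rate eps x * frozen_dev x w ord0 i - zhat b w ord0 i)).
    apply: eq_Rintegral => x; rewrite inE/= in_itv/= => /andP[sx xr].
    by apply: driftE; [exact: le_trans sx|exact: le_trans rb].
  rewrite RintegralB//; last by apply: integrableS intgy => //; exact: sub_ab.
  have mu_sr : fine (mu `[s, r]%classic) = r - s.
    rewrite lebesgue_measure_itv/= lte_fin; case: ltP => [//|rs].
    by have -> : r = s; [apply/eqP; rewrite eq_le rs|rewrite subrr].
  by congr (_ - _); rewrite -mu_sr mulrC; exact: Rintegral_cst.
rewrite Hs Hr /frozen_dev !mxE.
have -> : \int[mu]_(x in `[s, b]) drift x w i =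
  \int[mu]_(x in `[r, b]) drift x w i +
  (\int[mu]_(x in `[s, r]) (clock_rate eps x * frozen_dev x w ord0 i) -
   (r - s) * zhat b w ord0 i).
  by rewrite -Hsr -Hd; ring.
by ring.
Qed.

Lemma random_vector_frozen_dev s : a <= s <= b -> random_vector (frozen_dev s).
Proof.
move=> sab; have /random_vectorP rZ := random_vector_Z sab.
have /random_vectorP rz := random_vector_zhat.
apply/random_vectorP => i.
rewrite (_ : (fun w => _) = fun w => Z s w ord0 i + - (1 - s) * zhat b w ord0 i).
  by apply: measurable_funD => //; exact: measurable_funM.
by apply/funext => w; rewrite !mxE mulNr.
Qed.

Lemma ae_within_continuous_frozen_dev :
  {ae P, forall w, forall i,
    {within `[a, b], continuous (fun s => frozen_dev s w ord0 i)}}.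
Proof.
have [_ cZ _ _] := hZ; apply: filterS cZ => w cZ i.
rewrite (_ : (fun s => _) = fun s => Z s w ord0 i - (1 - s) * zhat b w ord0 i).
  move=> s; apply: cvgB; first exact: cZ.
  apply: cvgM; last exact: cvg_cst.
  apply: cvgB; first exact: cvg_cst.
  by move: s; apply: continuous_subspaceT => x; exact: cvg_id.
by apply/funext => s; rewrite !mxE.
Qed.

Lemma frozen_dev_gauss : 0 < a ->
  gauss_indep P (F b) (b ^+ 2 * (expR (A a) - 1))
    (fun w => expR (clock b eps a) *: frozen_dev a w - frozen_dev b w).
Proof.
move=> a0; have b0 : 0 < b by exact: lt_trans ab.
have aab : a <= a <= b by rewrite lexx ltW.
have bab : a <= b <= b by rewrite lexx (ltW ab).
have [hF1 _] := hF; have [sFb Fbm] := hF1 b bab.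
have [_ _ intd solZ] := hZ.
have /choice[J HJ] : forall s, exists Js : Omega -> 'rV[R]_d, a <= s <= b ->
    is_reverse_ito_integral P W eps s b Js /\
    {ae P, forall w, Z s w = Z b w - \row_i (\int[mu]_(x in `[s, b])
       fm_drift eps x (zhat x w) (Z x w) ord0 i) + Js w}.
  move=> s; have [sab|nsab] := pselect (a <= s <= b); last by exists (fun=> 0).
  by have [Js ito_J ae_J] := solZ s sab; exists Js.
pose p := part a b.
have p_in n k : (k <= n.+1)%N -> a <= p n k <= b by exact: part_in.
pose c n k := b / p n k * expR (A (p n k) / 2).
pose I s r := \int[mu]_(x in `[s, r]) (eps x ^+ 2).
pose X n w := \sum_(k < n.+1) c n k *: (J (p n k) w - J (p n k.+1) w).
pose v n := \sum_(k < n.+1) c n k ^+ 2 * I (p n k) (p n k.+1).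
have gX n : gauss_indep P (F b) (v n) (X n).
  apply: (ito_partition_gauss (ltW ab) hF hW (f := eps) (p := p n) (N := n.+1)
    (J := fun k => J (p n k)) (c n) (I := fun k => I (p n k) (p n k.+1))).
  - exact: (measurable_eps a0 b1 heps hA).
  - by move=> k _; exact: part_lt.
  - by move=> k kn; exact: p_in.
  - by move=> k kn; have [] := HJ _ (p_in n k kn).
  - move=> k kn; have /andP[ap _] := p_in n k (ltnW kn).
    have /andP[_ pb] := p_in n k.+1 kn.
    by have [] := integral_eps2 a0 hA ap (ltW (part_lt ab n k)) pb.
have v_cvg : v n @[n --> \oo] --> b ^+ 2 * (expR (A a) - 1).
  have Ab : expR (A b) = 1 by rewrite /noise_exponent set_itv1 Rintegral_set1 expR0.
  rewrite -[X in _ - X]Ab.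
  apply: (@exp_riemann_limit _ a b ab (fun s => A s) I b a0).
  - exact: (continuous_noise_exponent ab hA).
  - by move=> s r as_ sr rb; exact: (noise_exponent_le hA).
  - by move=> s r as_ sr rb; have [] := integral_eps2 a0 hA as_ sr rb.
set L := fun w => _.
have rL : random_vector L.
  have /random_vectorP ra := random_vector_frozen_dev aab.
  have /random_vectorP rb := random_vector_frozen_dev bab.
  apply/random_vectorP => i.
  rewrite (_ : (fun w => _) = fun w => expR (clock b eps a) * frozen_dev a w ord0 i -
    frozen_dev b w ord0 i).
    by apply: measurable_funB => //; exact: measurable_funM.
  by apply/funext => w; rewrite !mxE.
have XL : {ae P, forall w, forall i, X n w ord0 i @[n --> \oo] --> L w ord0 i}.
  (* The grid points of all partitions are countable, so one null set serves them all. *)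
  have aeJ : {ae P, forall w, forall n k, (k <= n.+1)%N ->
      Z (p n k) w = Z b w - \row_i (\int[mu]_(x in `[p n k, b])
         fm_drift eps x (zhat x w) (Z x w) ord0 i) + J (p n k) w}.
    apply: ae_foralln => n; apply: ae_foralln => k.
    have [kn|kn] := leqP k n.+1; last by apply: aeW.
    by have [_] := HJ _ (p_in n k kn); apply: filterS => w h _.
  apply: filterS3 hfrozen ae_within_continuous_frozen_dev (filterI aeJ intd).
  move=> w frz cdev [EJ intd_w] i.
  have incr n k (kn : (k < n.+1)%N) := @frozen_dev_increment J w a0 frz intd_w
    (p n k) (p n k.+1) (proj1 (andP (p_in n k (ltnW kn)))) (ltW (part_lt ab n k))
    (proj2 (andP (p_in n k.+1 kn))) (EJ n k (ltnW kn)) (EJ n k.+1 kn) i.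
  have intgy := (incr 0%N 0%N isT).1.
  have := variation_of_constants ab (cdev i) (continuous_clock a0 ab hA)
    (fun s sab => clock_rate_ge0 eps a0 sab) (integrable_clock_rate a0 hA) intgy
    (fun s r as_ sr rb => integral_clock_rate a0 hA as_ sr rb).
  rewrite clock_b expR0 mul1r.
  rewrite [X in _ --> X -> _](_ : _ = L w ord0 i); last by rewrite !mxE.
  rewrite [X in X @ _ --> _ -> _](_ : _ = fun n => X n w ord0 i)//.
  apply/funext => n; rewrite summxE; apply: eq_bigr => k _.
  have -> : (c n k *: (J (p n k) w - J (p n k.+1) w)) ord0 i =
      c n k * (J (p n k) w ord0 i - J (p n k.+1) w ord0 i) by rewrite !mxE.
  rewrite (incr n k (ltn_ord k)).2 (expR_clock eps a0 ab)//.
  have /andP[ap _] := p_in n k (ltnW (ltn_ord k)).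
  exact: lt_le_trans ap.
apply: (gauss_indep_cvg (v_ := v) (X_ := X)) => //.
- exact: sigma_algebraT.
- move=> n; apply: sumr_ge0 => k _; rewrite mulr_ge0 ?sqr_ge0//.
  by apply: Rintegral_ge0 => x _; exact: sqr_ge0.
- rewrite mulr_ge0 ?sqr_ge0// subr_ge0 -expR0 ler_expR.
  by apply: Rintegral_ge0 => x _; rewrite divr_ge0 ?sqr_ge0.
move=> i delta delta0; apply: ae_cvg_in_probability => //.
- by move=> n; move: i; apply/random_vectorP; exact: (gX n).1.
- by move: i; apply/random_vectorP.
- by apply: filterS XL => w; exact.
Qed.

(** Otherwise the drift would be at least [c / r] near [0], hence not
    integrable. *)
Lemma frozen_dev_at_0 : a = 0 -> {ae P, forall w, frozen_dev a w = 0}.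
Proof.
move=> a0; have b0 : 0 < b by rewrite -a0.
have [_ _ intd _] := hZ.
apply: filterS3 hfrozen ae_within_continuous_frozen_dev intd.
move=> w frz cdev intd_w; apply/rowP => i; rewrite [RHS]mxE.
apply/eqP/negPn/negP => y0.
pose y s := frozen_dev s w ord0 i.
(* By continuity [|Y|] stays above half its value at 0 on an interval [[0, r0]]. *)
pose c := `|y a| / 2; have c0 : 0 < c by rewrite divr_gt0// normr_gt0.
have [dl dl0 Hdl] := uniform_continuity_itv (cdev i) c0.
pose r0 := Num.min (dl / 2) b.
have r00 : 0 < r0 by rewrite lt_min divr_gt0.
(* Adding the constant back leaves [g * Y] for [r > 0], and [g] is at least [1 / r]. *)
pose f r := fm_drift eps r (zhat r w) (Z r w) ord0 i + zhat b w ord0 i.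
apply: (@not_integrable_inv _ f c r0 c0 r00).
  have intdr : mu.-integrable `[0, r0] (EFin \o (fun r => fm_drift eps r (zhat r w)
    (Z r w) ord0 i)).
    apply: integrableS (intd_w i) => //.
    by apply: subset_itv; rewrite bnd_simp ?a0// ge_min lexx orbT.
  exact: (integrableD (mI 0 r0) intdr (intc (zhat b w ord0 i) 0 r0)).
move=> r /andP[r_gt0]; rewrite le_min => /andP[rdl rb].
have rab : a <= r <= b by rewrite a0 (ltW r_gt0).
have -> : f r = clock_rate eps r * y r.
  rewrite /f /y /frozen_dev frz// /fm_drift !mxE fm_driftE ?subrK//.
  by rewrite gt_eqF.
have yr : c <= `|y r|.
  have : `|y a - y r| < c.
    apply: Hdl => //; first by rewrite lexx ltW.
    by rewrite a0 sub0r normrN gtr0_norm// (le_lt_trans rdl)// ltr_pdivrMr//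
      ltr_pMr// ltr1n.
  have := ler_distD 0 (y a) (y r).
  have := lerB_normD (y a - y r) (y r).
  rewrite /c; have := ler_normD (y a - y r) (y r); rewrite subrK; lra.
have q0 : 0 <= eps r ^+ 2 / r ^+ 2 / 2 by rewrite !divr_ge0 ?sqr_ge0.
have r10 : 0 <= r^-1 by rewrite invr_ge0 ltW.
rewrite normrM ger0_norm; last by rewrite addr_ge0.
rewrite mulrC; apply: ler_pM => //; first exact: ltW.
by rewrite lerDl.
Qed.
End frozen_step.


Theorem theorem4p3 (R : realType) (dO : measure_display)
    (Omega : measurableType dO) (P : probability Omega R) (d : nat)
    (* the reverse step from t to t' *)
    (t' t : R) (ht' : 0 <= t') (ht't : t' < t) (ht : t <= 1)
    (* the noise level, with A(t', t) finite *)
    (eps : R -> R) (heps : forall s, 0 <= s <= 1 -> 0 <= eps s)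
    (hA : lebesgue_measure.-integrable `[t', t]
            (fun s : R => (eps s ^+ 2 / s ^+ 2)%:E))
    (* clean latent and noise *)
    (z0 e : Omega -> 'rV[R]_d)
    (hz0 : random_vector z0) (hz0int : integrable_vector P z0)
    (he : isotropic_gaussian P 1 e)
    (hz0e : indep_sigma P (sigma_of z0) (sigma_of e))
    (* the reverse-time SDE *)
    (F : R -> set_system Omega) (hF : reverse_filtration t' t F)
    (W : R -> Omega -> 'rV[R]_d) (hW : reverse_brownian P t' t F W)
    (zhat Z : R -> Omega -> 'rV[R]_d)
    (hZt : {ae P, forall w, Z t w = fm_path t (z0 w) (e w)})
    (hzhat : is_cond_mean P z0 (Z t) (zhat t))
    (hZ : reverse_sde_solution P t' t F W
            (fun s w => fm_drift eps s (zhat s w) (Z s w)) eps Z)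
    (* frozen posterior mean on [t', t] *)
    (hfrozen : {ae P, forall w, forall s : R, t' <= s <= t ->
                 zhat s w = zhat t w}) :
  exists w : Omega -> 'rV[R]_d,
    [/\ isotropic_gaussian P 1 w,
        indep_sigma P (sigma_of w) (sigma_of (Z t)) &
        {ae P, forall x, Z t' x =
          (1 - t') *: zhat t x
          + (t' / t * expR (- noise_exponent eps t' t / 2))
              *: (Z t x - (1 - t) *: zhat t x)
          + (t' * Num.sqrt (1 - expR (- noise_exponent eps t' t))) *: w x}].
Proof.
have ttt : t' <= t <= t by rewrite lexx ltW.
have t0 : 0 < t by exact: le_lt_trans ht't.
have [hF1 _] := hF; have [sFt Ftm] := hF1 t ttt.
have FT := sigma_algebraT sFt.
have [adZ _ _ _] := hZ.
have [zhatZ _ _] := hzhat.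
have conclude (w : Omega -> 'rV[R]_d) : gauss_indep P (F t) 1 w ->
    isotropic_gaussian P 1 w /\ indep_sigma P (sigma_of w) (sigma_of (Z t)).
  move=> gw; split; first exact: gauss_indep_isotropic gw.
  by apply: gauss_indep_sigma gw => //; exact: adZ.
(* A witness for the cases in which the noise term has coefficient 0. *)
have [w0 gw0] : exists w0 : Omega -> 'rV[R]_d, gauss_indep P (F t) 1 w0.
  have st0 : 0 < t - t' by rewrite subr_gt0.
  have inc := brownian_increment hW (lexx t') ht't (lexx t).
  exists (fun w => (Num.sqrt (t - t'))^-1 *: (W t' w - W t w)).
  exact: gauss_indep_normalize st0 inc.
move: ht'; rewrite le_eqVlt => /orP[/eqP t'0|t'0].
  have [iw iZ] := conclude w0 gw0; exists w0; split => //.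
  have := frozen_dev_at_0 ht't hZ hfrozen (esym t'0).
  apply: filterS => w /eqP; rewrite /frozen_dev subr_eq0 => /eqP ->.
  by rewrite -t'0 !mul0r !scale0r !addr0.
pose A := noise_exponent eps t' t.
have A0 : 0 <= A by apply: Rintegral_ge0 => x _; rewrite divr_ge0 ?sqr_ge0.
have gL := frozen_dev_gauss ht't ht heps hA hF hW zhatZ hZ hfrozen t'0.
pose L w := expR (clock t eps t') *: frozen_dev t zhat Z t' w - frozen_dev t zhat Z t w.
(* [L] is [Phi(t') Y_t' - Y_t]; solving for [Z t'] uses [1 / Phi(t') = (t' / t) * exp (- A / 2)]. *)
have Z_L w : Z t' w = (1 - t') *: zhat t w + (t' / t * expR (- A / 2)) *:
    (Z t w - (1 - t) *: zhat t w) + (t' / t * expR (- A / 2)) *: L w.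
  rewrite -addrA -scalerDr addrC /L [_ + (_ - frozen_dev _ _ _ t w)]addrC subrK.
  rewrite scalerA (expR_clock eps t'0 ht't t'0).
  rewrite [X in X *: _](_ : _ = 1) ?scale1r ?subrK//.
  rewrite mulrACA -expRD mulNr addNr expR0 mulr1.
  by field; rewrite !gt_eqF.
have [A_eq0|An0] := eqVneq A 0.
  have [iw iZ] := conclude w0 gw0; exists w0; split => //.
  have gL0 : gauss_indep P (F t) 0 L.
    by move: gL; rewrite -/A A_eq0 expR0 subrr mulr0.
  apply: filterS (gauss_indep_0_ae FT gL0) => w Lw.
  rewrite [LHS]Z_L Lw -/A A_eq0 oppr0 expR0 subrr sqrtr0 mulr0 scale0r.
  by rewrite scaler0.
have eA : 0 < expR A - 1 by rewrite subr_gt0 -expR0 ltr_expR lt_def An0.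
pose v := t ^+ 2 * (expR A - 1).
have v0 : 0 < v by rewrite mulr_gt0// exprn_gt0.
pose w := fun x => (Num.sqrt v)^-1 *: L x.
have gw : gauss_indep P (F t) 1 w := gauss_indep_normalize v0 gL.
have [iw iZ] := conclude w gw; exists w; split => //.
apply: aeW => x; rewrite [LHS]Z_L; congr (_ + _).
rewrite /w scalerA; congr (_ *: _).
have sv : Num.sqrt v != 0 by rewrite gt_eqF ?sqrtr_gt0.
apply: (mulIf sv); rewrite mulfVK//.
have -> : Num.sqrt v = t * Num.sqrt (expR A - 1).
  by rewrite /v sqrtrM ?sqr_ge0// sqrtr_sqr gtr0_norm.
(* The decay factor taken under the root turns the standard deviation of [L] into that of the
   claim. *)
have eA' : expR (- A / 2) * Num.sqrt (expR A - 1) = Num.sqrt (1 - expR (- A)).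
  rewrite -[expR (- A / 2)]ger0_norm ?expR_ge0// -sqrtr_sqr -sqrtrM ?sqr_ge0//.
  congr Num.sqrt; rewrite expr2 -expRD.
  have -> : - A / 2 + - A / 2 = - A by field.
  by rewrite mulrBr mulr1 -expRD addNr expR0.
by rewrite -eA' -/A; field; rewrite gt_eqF.
Qed.
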